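(* Let $p>1$ be an integer, put $q=1/p$, and let $c=a/b$ be a rational number ($a,b$ integers, $b\neq 0$) such that $cp^k\ne 1$ for every $k=1,2,\ldots$. Let $$L=\sum_{k=1}^\infty\frac{1}{cp^k-1}.$$ Let $a_n$ and $b_n$ be given by $$b_n = b^{2n}\,d_n(p)\,(c;p)_n\,P_n(cp^n|q),\qquad a_n = b^{2n}\,d_n(p)\,(c;p)_n\,Q_n(cp^n|q)+b_n\sum_{k=1}^{n-1}\frac{1}{cp^k-1},$$ where $d_n(p)$ is the product of the first $n$ cyclotomic polynomials evaluated at $p$, $P_n(\cdot|q)$ is the little $q$-Legendre polynomial and $Q_n(\cdot|q)$ its associated polynomial (all defined in the context). Then $a_n,b_n\in\mathbb{Z}$, and $$\lim_{n\to\infty}|b_nL-a_n|^{1/n^2}=p^{-\frac{\pi^2-3}{\pi^2}}<1,$$ which implies that the infinite sum $L$ is irrational. Its measure of irrationality satisfies $r(L)\le\frac{3\pi^2}{\pi^2-3}=4.310119\ldots$.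
   Context: For any numbers $u,t$ let $(u;t)_0=1$ and $(u;t)_k=(1-u)(1-ut)\cdots(1-ut^{k-1})$ (used with $t=q$ and $t=p$). The little $q$-Legendre polynomials are, for $0<q<1$, $$P_n(x|q)=\sum_{k=0}^n \frac{(q^{-n};q)_k\,(q^{n+1};q)_k}{(q;q)_k\,(q;q)_k}\,q^k x^k .$$ The associated polynomial $Q_n(x|q)$ (of degree $n-1$ in $x$) is $$Q_n(x|q)=\sum_{j=0}^\infty \frac{P_n(x|q)-P_n(q^j|q)}{x-q^j}\,q^j .$$ $d_n(p)=\prod_{k=1}^n\Phi_k(p)$, where $\Phi_k$ is the $k$-th cyclotomic polynomial. The measure of irrationality of a real number $x$ is $$r(x)=\inf\{r\in\mathbb{R}: |x-s/t|<1/t^r \text{ has at most finitely many integer solutions } (s,t)\}.$$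
   Formalization: The limit formula is stated only for c ≠ 1 (for c = 1, (c;p)_n = 0, so a_n = b_n = 0 and the limit is 0), and all claims about L only for c ≠ 0 (for c = 0 the series L diverges); irrationality and the bound on r(L) are kept for c = 1. *)

(* Defs.v *)
From HB Require Import structures.
From mathcomp Require Import all_boot all_order all_algebra all_field.
From mathcomp Require Import all_classical all_reals all_analysis.
Set Implicit Arguments.
Unset Strict Implicit.
Unset Printing Implicit Defensive.
Import Order.TTheory GRing.Theory Num.Theory.
Import numFieldNormedType.Exports.
Local Open Scope classical_set_scope.
Local Open Scope ring_scope.

Definition qpoch (R : realType) (u t : R) (k : nat) : R :=
  \prod_(i < k) (1 - u * t ^+ i).

Definition littleqLegendre (R : realType) (q : R) (n : nat) (x : R) : R :=
  \sum_(k < n.+1)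
    (qpoch (q ^- n) q k * qpoch (q ^+ n.+1) q k) / (qpoch q q k * qpoch q q k)
    * q ^+ k * x ^+ k.

(* At a point x = q ^+ j the j-th summand is read as 0 (division by
   0), so this is the value of the degree n.-1 polynomial Q_n(.|q) only off
   the points q ^+ j (for n > 0). *)
Definition littleqLegendre_assoc (R : realType) (q : R) (n : nat) (x : R) : R :=
  \big[+%R/0]_(0 <= j <oo)
    ((littleqLegendre q n x - littleqLegendre q n (q ^+ j)) / (x - q ^+ j)
     * q ^+ j).

Definition cyclotomic_prod (n p : nat) : int :=
  \prod_(1 <= k < n.+1) ('Phi_k).[p%:Z].

Definition lambert_term (R : realType) (c : R) (p k : nat) : R :=
  1 / (c * p%:R ^+ k - 1).

Definition lambert_sum (R : realType) (c : R) (p : nat) : R :=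
  \big[+%R/0]_(1 <= k <oo) (lambert_term c p k).

Definition approx_den (R : realType) (p : nat) (a b : int) (n : nat) : R :=
  let c : R := a%:~R / b%:~R in
  let q : R := p%:R^-1 in
  b%:~R ^+ (2 * n) * (cyclotomic_prod n p)%:~R * qpoch c p%:R n
  * littleqLegendre q n (c * p%:R ^+ n).

Definition approx_num (R : realType) (p : nat) (a b : int) (n : nat) : R :=
  let c : R := a%:~R / b%:~R in
  let q : R := p%:R^-1 in
  b%:~R ^+ (2 * n) * (cyclotomic_prod n p)%:~R * qpoch c p%:R n
  * littleqLegendre_assoc q n (c * p%:R ^+ n)
  + approx_den R p a b n * \sum_(1 <= k < n) lambert_term c p k.

(* Since t ^ r with r real requires t > 0, the denominators range over the
   positive integers; s and t need not be coprime. *)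
Definition approximations (R : realType) (x r : R) : set (int * int) :=
  [set st | (0 < st.2) &&
    (`|x - st.1%:~R / st.2%:~R| < 1 / (st.2%:~R `^ r))].

(* The infimum is taken in \bar R, so that it is +oo if no r qualifies. *)
Definition irrationality_measure (R : realType) (x : R) : \bar R :=
  ereal_inf (EFin @` [set r : R | finite_set (approximations x r)]).

(* Main.v *)
(* Put x = c p^n. The form b_n L - a_n equals b^(2n) d_n(p) (c;p)_n R_n with
   R_n = sum_j P_n(q^j) q^j / (x - q^j), and expanding R_n in powers of 1/x
   brings in the moments S_m = sum_j q^(j(m+1)) P_n(q^j). The q-Chu-Vandermonde
   sum gives P_n = sum_k e_k (q x; q)_k with integers e_k, whence the integrality
   (p^i - 1 divides d_n(p) for i <= n), and evaluates S_m: it vanishes for m < n,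
   and |S_n| is p^(-n(n+1)/2) up to a bounded factor, so that log |R_n| is
   -(3/2) n^2 log p + O(n).
   With log |(c;p)_n| ~ (1/2) n^2 log p, the exponent follows from
   log d_n(p) ~ (3/pi^2) n^2 log p. The latter comes from
   sum_(k <= n) log d_(n/k)(p) = sum_(m <= n) log (p^m - 1) and from
   sum 1/k^2 = pi^2/6. Finally log |b_n| <= (2 + 3/pi^2 + o(1)) n^2 log p, and the
   quality of the forms b_n L - a_n bounds the irrationality measure. For c = 1,
   where a_n = b_n = 0, the forms for c = p are used. *)
Require Import Defs.
From HB Require Import structures.
From mathcomp Require Import all_boot all_order all_algebra all_field.
From mathcomp Require Import all_classical all_reals all_analysis.
From mathcomp Require Import ring lra zify.
Set Implicit Arguments.
Unset Strict Implicit.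
Unset Printing Implicit Defensive.
Import Order.TTheory GRing.Theory Num.Theory.
Import numFieldNormedType.Exports.
Local Open Scope classical_set_scope.
Local Open Scope ring_scope.

(** Shifting the index turns the tail of L from k = n on into T = sum_j q^j / (x - q^j). This is the
    Stieltjes transform, at x = c p^n, of the measure with mass q^j at q^j, for which the P_n are
    orthogonal; hence R_n = P_n(x) T - Q_n(x). The basis (q x; q)_k serves three times: P_n has
    integer coefficients in it, its q-beta sums give the moments in closed form, and its divided
    differences show that the p^i - 1 with i <= n are, apart from powers of b, the only denominators
    in Q_n(x). The moment S_n is bounded from below as well as from above because a limit is
    claimed. The lower bound serves again in the irrationality criterion: it settles the case where
    s/t equals a_n/b_n, taking the place of the usual nonvanishing determinant of consecutive forms.
    The criterion also needs |b_n| only from above, so a termwise estimate of P_n(x) is enough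
    there. *)

(** * Gaussian binomial coefficients *)

(** The Gaussian binomial coefficient at base p. The q-Pascal rule makes it a natural number by
    construction; its product formula is [qbin_falling]. *)
Fixpoint qbin (p n k : nat) : nat :=
  match n, k with
  | _, 0 => 1
  | 0, _.+1 => 0
  | n'.+1, k'.+1 => qbin p n' k' + p ^ k * qbin p n' k
  end.

Lemma qbinn0 p n : qbin p n 0 = 1%N.
Proof. by case: n. Qed.

Lemma qbinS p n k : qbin p n.+1 k.+1 = (qbin p n k + p ^ k.+1 * qbin p n k.+1)%N.
Proof. by []. Qed.

Lemma qbin_small p n k : (n < k)%N -> qbin p n k = 0%N.
Proof.
elim: n k => [|n IHn] [|k] //= ltnk.
by rewrite !IHn ?muln0//; lia.
Qed.

(** As a polynomial in p the coefficient has degree k (n - k) and nonnegative coefficients with sum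
    at most 2^n. *)
Lemma qbin_le p n k : (0 < p)%N -> (qbin p n k <= 2 ^ n * p ^ (k * (n - k)))%N.
Proof.
move=> p0; elim: n k => [|n IHn] [|k] //.
  by rewrite qbinn0 mul0n expn0 muln1 expn_gt0.
rewrite qbinS [(2 ^ _.+1)%N]expnS mul2n -addnn mulnDl leq_add//.
  apply: (leq_trans (IHn k)); rewrite leq_mul2l leq_pexp2l ?orbT//.
  by rewrite subSS leq_mul2r leqnSn orbT.
case: (leqP k.+1 n) => [lekn|ltnk]; last by rewrite qbin_small// muln0.
apply: (leq_trans (leq_mul (leqnn _) (IHn k.+1))).
by rewrite mulnCA -expnD leq_mul2l leq_pexp2l ?orbT//; nia.
Qed.

(** * Shifted factorials: reversal and inversion of the base *)

Section QPochhammer.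
Variable R : realType.
Implicit Types (u x t : R) (k n : nat).

Lemma qpoch0 u t : qpoch u t 0 = 1.
Proof. by rewrite /qpoch big_ord0. Qed.

Lemma qpochS u t k : qpoch u t k.+1 = qpoch u t k * (1 - u * t ^+ k).
Proof. by rewrite /qpoch big_ord_recr. Qed.

Lemma qpochSl u t k : qpoch u t k.+1 = (1 - u) * qpoch (u * t) t k.
Proof.
rewrite /qpoch big_ord_recl expr0 mulr1; congr (_ * _).
by apply: eq_bigr => i _; rewrite /= /bump add1n exprS mulrA.
Qed.

Lemma qpochD u t k n : qpoch u t (k + n) = qpoch u t k * qpoch (u * t ^+ k) t n.
Proof.
elim: n => [|n IHn]; first by rewrite addn0 qpoch0 mulr1.
by rewrite addnS !qpochS IHn mulrA -(mulrA u) -exprD.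
Qed.

(** Both sides are the product of 1 - u t^i over 1 <= i <= k, read in opposite orders. *)
Lemma qpoch_rev u t k : t != 0 ->
  qpoch (u * t ^+ k) t^-1 k = qpoch (u * t) t k.
Proof.
move=> t0; elim: k => [|k IHk]; first by rewrite !qpoch0.
rewrite qpochSl qpochS exprSr mulrA mulfK// IHk.
by rewrite [RHS]mulrC -!mulrA -exprSr exprS.
Qed.

(** Each factor satisfies 1 - 1/(u t^i) = - (1 - u t^i) / (u t^i). This carries base q to base p,
    where the Gaussian binomials live. *)
Lemma qpochV u t k : u != 0 -> t != 0 ->
  qpoch u^-1 t^-1 k = (-1) ^+ k * u ^- k * t ^- 'C(k, 2) * qpoch u t k.
Proof.
move=> u0 t0; elim: k => [|k IHk]; first by rewrite !qpoch0 !expr0 invr1 !mulr1.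
rewrite !qpochS IHk binS bin1 exprD !exprS exprVn.
by field; rewrite ?u0 ?expf_neq0// t0.
Qed.

Lemma qpoch_neq0 u t k : (forall i, (i < k)%N -> u * t ^+ i != 1) -> qpoch u t k != 0.
Proof. by move=> ne1; apply/prodf_neq0 => i _; rewrite subr_eq0 eq_sym ne1. Qed.

End QPochhammer.

(** * The q-binomial theorem and the q-Chu-Vandermonde sum *)

Section QBinomial.
Variables (R : realType) (p : nat).
Hypothesis p_gt1 : (1 < p)%N.
Let t : R := p%:R.

Let t_gt1 : 1 < t. Proof. by rewrite /t ltr1n. Qed.
Let t_neq0 : t != 0. Proof. by rewrite gt_eqF// (lt_trans ltr01). Qed.

Lemma expt_neq1 i : t ^+ i.+1 != 1.
Proof. by rewrite gt_eqF// exprn_egt1. Qed.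

Lemma qpochtt_neq0 k n : qpoch (t ^+ n.+1) t k != 0.
Proof. by apply: qpoch_neq0 => i _; rewrite -exprD addSn expt_neq1. Qed.

(** For k > n both sides vanish, the right one through its factor of index n. *)
Lemma qbin_falling n k : (qbin p n k)%:R * qpoch t t k = qpoch (t ^+ n) t^-1 k.
Proof.
elim: n k => [|n IHn] [|k]; rewrite ?qpoch0 ?qbinn0 ?mulr1//=.
  by rewrite mul0r expr0 qpochSl subrr mul0r.
rewrite natrD natrM natrX mulrDl -mulrA IHn !qpochS mulrA IHn.
rewrite -(qpochS (t ^+ n.+1)) qpochSl [t ^+ n.+1 / t](_ : _ = t ^+ n).
  rewrite exprVn -/t !exprSr.
  by field; rewrite expf_neq0.
by rewrite exprSr mulfK.
Qed.

Lemma qbin_rising n k : (qbin p (n + k) k)%:R * qpoch t t k = qpoch (t ^+ n.+1) t k.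
Proof. by rewrite qbin_falling exprD qpoch_rev// -exprSr. Qed.

(** Both sides count flags of subspaces of dimensions k and k + l in dimension n; the proof clears
    (t;t)_k (t;t)_l and compares falling products. *)
Lemma qbin_mul n k l :
  (qbin p n (k + l))%:R * (qbin p (k + l) k)%:R =
  (qbin p n k)%:R * (qbin p (n - k) l)%:R :> R.
Proof.
have [lenk|ltnk] := leqP k n; last first.
  by rewrite qbin_small ?(@qbin_small _ n k)// ?mul0r//; lia.
have h1 := qbin_falling n (k + l); have h2 := qbin_rising l k.
have h3 := qbin_falling n k; have h4 := qbin_falling (n - k) l.
have kl : (k + l = l + k)%N by rewrite addnC.
apply: (mulIf (mulf_neq0 (qpochtt_neq0 k 0) (qpochtt_neq0 l 0))).
rewrite expr1 {2}kl.
have -> : (qbin p n (k + l))%:R * (qbin p (l + k) k)%:R * (qpoch t t k * qpoch t t l) =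
  (qbin p n (k + l))%:R * (qpoch t t l * ((qbin p (l + k) k)%:R * qpoch t t k)) by ring.
have -> : (qbin p n k)%:R * (qbin p (n - k) l)%:R * (qpoch t t k * qpoch t t l) =
  ((qbin p n k)%:R * qpoch t t k) * ((qbin p (n - k) l)%:R * qpoch t t l) by ring.
rewrite h2 h3 h4 exprS -qpochD addnC -kl h1 qpochD exprVn.
by rewrite expfB_cond ?(negbTE t_neq0).
Qed.

Lemma qbinomial_theorem x N :
  qpoch x t N = \sum_(j < N.+1) (-1) ^+ j * (qbin p N j)%:R * t ^+ 'C(j, 2) * x ^+ j.
Proof.
elim: N x => [|N IHN] x; first by rewrite big_ord1 qpoch0 /= bin0n !mulr1.
rewrite qpochSl IHN mulrBl mul1r mulr_sumr.
rewrite [RHS]big_ord_recl [in X in X - _]big_ord_recl !qbinn0 bin0n !mulr1.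
rewrite -addrA; congr (_ + _).
rewrite [in RHS](eq_bigr (fun j : 'I_N.+1 =>
   (-1) ^+ j.+1 * (qbin p N j.+1)%:R * t ^+ 'C(j.+1, 2) * (x * t) ^+ j.+1 +
   (-1) ^+ j.+1 * (qbin p N j)%:R * t ^+ 'C(j.+1, 2) * x ^+ j.+1)); last first.
  move=> j _; rewrite lift0 qbinS natrD natrM natrX -/t exprMn; ring.
rewrite big_split/= [X in _ = X + _]big_ord_recr/= qbin_small// mulr0 !mul0r addr0.
congr (_ + _).
rewrite -sumrN; apply: eq_bigr => j _.
rewrite binS bin1 exprD exprMn !exprS; ring.
Qed.

Definition qdiff_sum (y : R) N (f : nat -> R) : R :=
  \sum_(j < N.+1) (-1) ^+ (N - j) * (qbin p N j)%:R * t ^+ 'C(N - j, 2) * y ^+ (N - j) * f j.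

(* The N-th q-difference operator is the product over i < N of E - y p^i, where
   E is the shift. *)
Lemma qdiff_sumS y N f :
  qdiff_sum y N.+1 f = qdiff_sum y N (fun j => f j.+1 - y * t ^+ N * f j).
Proof.
rewrite /qdiff_sum big_ord_recl.
rewrite (eq_bigr (fun j : 'I_N.+1 =>
  (-1) ^+ (N - j) * (qbin p N j)%:R * t ^+ 'C(N - j, 2) * y ^+ (N - j) * f j.+1 +
  t ^+ j.+1 * ((-1) ^+ (N - j) * (qbin p N j.+1)%:R * t ^+ 'C(N - j, 2) * y ^+ (N - j) * f j.+1)));
  last first.
  move=> j _; rewrite lift0 subSS natrD natrM natrX -/t; ring.
rewrite big_split/= addrCA.
rewrite [RHS](eq_bigr (fun j : 'I_N.+1 =>
  (-1) ^+ (N - j) * (qbin p N j)%:R * t ^+ 'C(N - j, 2) * y ^+ (N - j) * f j.+1 +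
  - (t ^+ j * ((-1) ^+ (N - j) * (qbin p N j)%:R * t ^+ 'C((N - j).+1, 2)
      * y ^+ (N - j).+1 * f j)))); last first.
  move=> j _; rewrite mulrBr; congr (_ - _).
  have -> : t ^+ N = t ^+ j * t ^+ (N - j) by rewrite -exprD subnKC// -ltnS.
  rewrite binS bin1 exprD [y ^+ _.+1]exprS.
  move: (_ ^+ _) (_ ^+ _) (_ ^+ _) (_ ^+ _) (_ ^+ _) => *; ring.
rewrite big_split/=; congr (_ + _).
rewrite [RHS]big_ord_recl [in LHS]big_ord_recr [qbin p N _.+1]qbin_small//= !(mulr0, mul0r) addr0.
rewrite !subn0 !qbinn0 mul1r exprS; congr (_ + _); first ring.
apply: eq_bigr => j _; rewrite /bump leq0n add1n.
have -> : (N - j = (N - j.+1).+1)%N by have := ltn_ord j; lia.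
rewrite [(-1) ^+ _.+1]exprS; ring.
Qed.

(** The condition on y makes the last factor of the difference operator E - A/B. Applied to f_j =
    (A;t)_j / (B;t)_j it gives (1 - A/B) / (1 - B) times (A;t)_j / (B t;t)_j, so the induction goes
    on with B t for B and the same y. *)
Lemma q_chu_vandermonde y A B N : B != 0 -> y * t ^+ N = A / B * t ->
  (forall i, (i < N)%N -> B * t ^+ i != 1) ->
  qdiff_sum y N (fun j => qpoch A t j / qpoch B t j) =
  qpoch (A / B) t^-1 N / qpoch B t N.
Proof.
elim: N A B y => [|N IHN] A B y B0 yE Bne1.
  by rewrite /qdiff_sum big_ord1 /= bin0n !qpoch0 !divr1 !mulr1.
have {}yE : y * t ^+ N = A / B.
  by apply: (mulIf t_neq0); rewrite -yE exprSr mulrA.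
rewrite qdiff_sumS !qpochSl -[A / B / t]mulrA -[B^-1 / t]invfM -mulf_div.
have B1 : 1 - B != 0 by have := Bne1 0%N isT; rewrite expr0 mulr1 subr_eq0 eq_sym.
rewrite -(IHN A (B * t) y); first last.
- by move=> i iN; rewrite -mulrA -exprS Bne1.
- by rewrite yE; field; rewrite B0 t_neq0.
- by rewrite mulf_neq0.
rewrite /qdiff_sum mulr_sumr; apply: eq_bigr => j _.
rewrite yE.
have jN : (j <= N)%N by rewrite -ltnS.
have D0 : qpoch B t j != 0 by apply: qpoch_neq0 => i ij; apply: Bne1; lia.
have D1 : 1 - B * t ^+ j != 0 by rewrite subr_eq0 eq_sym Bne1.
have D2 : qpoch (B * t) t j != 0.
  by apply: qpoch_neq0 => i ij; rewrite -mulrA -exprS; apply: Bne1; lia.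
have e1 : qpoch B t j.+1 = (1 - B) * qpoch (B * t) t j by rewrite qpochSl.
have e2 : qpoch (B * t) t j = qpoch B t j * (1 - B * t ^+ j) / (1 - B).
  by rewrite -qpochS e1 mulrAC divff// mul1r.
rewrite !qpochS e2.
by field; rewrite ?B0 ?D0 ?D1 ?B1.
Qed.

End QBinomial.

(** * Little q-Legendre polynomials in the basis (q x; q)_k *)

Section LittleQLegendre.
Variables (R : realType) (p : nat).
Hypothesis p_gt1 : (1 < p)%N.
Let t : R := p%:R.
Let q : R := t^-1.

Let t_gt1 : 1 < t. Proof. by rewrite /t ltr1n. Qed.
Let t_neq0 : t != 0. Proof. by rewrite gt_eqF// (lt_trans ltr01). Qed.

(* The coefficients of P_n in the basis (q x; q)_k. Unlike those in the basis
   x^k they are integers. *)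
Definition legendre_coef n k : R :=
  (-1) ^+ (n - k) * (qbin p n k * qbin p (n + k) k * p ^ 'C((n - k).+1, 2))%:R.

Lemma qpochqq_neq0 k n : qpoch (q ^+ n.+1) q k != 0.
Proof.
apply: qpoch_neq0 => i _; rewrite -exprD addSn exprVn.
by rewrite -(inj_eq invr_inj) invrK invr1 expt_neq1.
Qed.

Lemma littleqLegendre_coefE n k :
  (qpoch (q ^- n) q k * qpoch (q ^+ n.+1) q k) / (qpoch q q k * qpoch q q k) * q ^+ k =
  (-1) ^+ k * (qbin p n k)%:R * (qbin p (n + k) k)%:R * t ^+ 'C(k, 2) / t ^+ (n * k).
Proof.
have := qbin_falling R p_gt1 n k; have := qbin_rising R p_gt1 n k.
have tk0 := qpochtt_neq0 R p_gt1 k 0; rewrite expr1 in tk0.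
rewrite -/t -exprVn invrK.
move=> /(canRL (mulfK tk0)) -> /(canRL (mulfK tk0)) ->.
have -> : q ^+ n.+1 = (t ^+ n.+1)^-1 by rewrite exprVn.
rewrite !qpochV ?expf_neq0// -/t.
rewrite !exprVn -exprM mulSn exprD mulnC.
rewrite -signr_odd -/q; case: odd; rewrite ?expr1 ?expr0;
  by field; rewrite tk0 !expf_neq0.
Qed.

Lemma qpoch_shiftE x k : qpoch (q * x) q k = qpoch (x * q ^+ k) t k.
Proof.
rewrite -[x * q ^+ k](mulfVK t_neq0) -qpoch_rev//; congr (qpoch _ _ _).
rewrite -/q exprVn; field; rewrite expf_neq0// t_neq0.
Qed.

(** This compares the coefficients of x^j in the two expansions of P_n. [qbin_mul] extracts the
    right-hand side as a factor; what remains is a q-Chu-Vandermonde sum with A = t^(n+j+1) and B =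
    t^(j+1), whose value is 1 because (t^n; t^-1)_(n-j) = (t^(j+1); t)_(n-j). *)
Lemma legendre_coef_sum n j : (j <= n)%N ->
  \sum_(k < n.+1) legendre_coef n k * ((-1) ^+ j * (qbin p k j)%:R * t ^+ 'C(j, 2) / t ^+ (k * j)) =
  (-1) ^+ j * (qbin p n j)%:R * (qbin p (n + j) j)%:R * t ^+ 'C(j, 2) / t ^+ (n * j).
Proof.
move=> lejn; set N := (n - j)%N.
have nE : n.+1 = (j + N.+1)%N by rewrite addnS subnKC.
rewrite nE big_split_ord/= big1 ?add0r; last first.
  by move=> i _; rewrite (qbin_small p (ltn_ord i)) !(mulr0, mul0r).
set A := t ^+ (n + j).+1; set B := t ^+ j.+1.
have AB : A / B = t ^+ n by rewrite /A -addnS exprD mulfK// expf_neq0.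
have cv : qdiff_sum p B N (fun l => qpoch A t l / qpoch B t l) = 1.
  rewrite q_chu_vandermonde//; last first.
  - by move=> i _; rewrite -exprD addSn expt_neq1.
  - by rewrite AB -exprD -exprSr; congr (_ ^+ _); lia.
  - by rewrite expf_neq0.
  rewrite AB /B -[n in t ^+ n](subnKC lejn) exprD qpoch_rev// -exprSr divff//.
  exact: qpochtt_neq0.
transitivity ((-1) ^+ j * (qbin p n j)%:R * (qbin p (n + j) j)%:R * t ^+ 'C(j, 2) / t ^+ (n * j)
  * qdiff_sum p B N (fun l => qpoch A t l / qpoch B t l)); last by rewrite cv mulr1.
rewrite /qdiff_sum mulr_sumr; apply: eq_bigr => l _.
have leln : (l <= N)%N by rewrite -ltnS.
have l0 := qpochtt_neq0 R p_gt1 (j + l) 0; rewrite expr1 in l0.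
have h1 := qbin_rising R p_gt1 n (j + l); have h2 := qbin_rising R p_gt1 n j.
rewrite qpochD in h1.
have e1 : (qbin p (n + (j + l)) (j + l))%:R =
  (qbin p (n + j) j)%:R * (qpoch A t l / qpoch B t l) :> R.
  apply: (mulIf l0); rewrite qpochD h1 qpochD -h2 -/t -exprS -/B -exprD addSn -/A.
  by field; exact: qpochtt_neq0.
have h3 := qbin_mul R p_gt1 n j l.
rewrite /legendre_coef !natrM e1 natrX -/t.
have -> : (n - (j + l) = N - l)%N by rewrite subnDA.
rewrite binS bin1 exprD /B -[in (_ ^+ _.+1) ^+ _]exprM.
have -> : (j.+1 * (N - l) = (N - l) + j * (N - l))%N by rewrite mulSn.
rewrite exprD.
have -> : (n * j = (j + l) * j + j * (N - l))%N.
  rewrite [(j * _)%N]mulnC -mulnDl; congr (_ * _)%N; lia.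
rewrite exprD.
have -> : forall a b c d e f g h i : R, a * (b * (c * d) * (e * f)) * (g * h * i / (t ^+ ((j + l) * j)))
   = (b * h) * a * c * d * e * f * g * i / (t ^+ ((j + l) * j)).
  by move=> *; field; rewrite expf_neq0.
rewrite h3 -/N.
by field; rewrite !expf_neq0// qpochtt_neq0.
Qed.

Lemma littleqLegendreE n x :
  littleqLegendre q n x = \sum_(k < n.+1) legendre_coef n k * qpoch (q * x) q k.
Proof.
rewrite [RHS](eq_bigr (fun k : 'I_n.+1 => \sum_(j < n.+1)
  legendre_coef n k * ((-1) ^+ j * (qbin p k j)%:R * t ^+ 'C(j, 2) / t ^+ (k * j)) * x ^+ j)).
  rewrite exchange_big; apply: eq_bigr => j _.
  by rewrite -mulr_suml legendre_coef_sum -1?ltnS// -littleqLegendre_coefE.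
move=> k _; rewrite qpoch_shiftE (qbinomial_theorem p) mulr_sumr.
rewrite (big_ord_widen n.+1 (fun j => legendre_coef n k *
   ((-1) ^+ j * (qbin p k j)%:R * t ^+ 'C(j, 2) * (x * q ^+ k) ^+ j)))//.
rewrite big_mkcond/=; apply: eq_bigr => j _; case: ltnP => [_|ltkj].
  by rewrite exprMn -exprM exprVn -/t; ring.
by rewrite qbin_small ?(mulr0, mul0r).
Qed.

End LittleQLegendre.

(** * Convergent series as a relation *)

Section InfiniteSums.
Variable R : realType.
Implicit Types (u v : nat -> R) (l a : R).

(** The infinite sums of the statement are limits, which take a default value when the series
    diverges; this relation carries convergence along with the value. *)
Definition has_sum u l : Prop := series u @ \oo --> l.

Lemma has_sum_lim u l : has_sum u l -> \big[+%R/0]_(0 <= j <oo) u j = l.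
Proof. exact: cvg_lim. Qed.

Lemma has_sum_unique u l a : has_sum u l -> has_sum u a -> l = a.
Proof. exact: cvg_unique. Qed.

Lemma has_sumD u v l a : has_sum u l -> has_sum v a -> has_sum (fun j => u j + v j) (l + a).
Proof. by move=> ul va; rewrite /has_sum (seriesD u v); apply: cvgD. Qed.

Lemma has_sumZ u l a : has_sum u l -> has_sum (fun j => a * u j) (a * l).
Proof. by move=> ul; rewrite /has_sum (seriesZ u a); apply: cvgZr. Qed.

Lemma has_sum0 : has_sum (fun=> 0) 0.
Proof.
rewrite /has_sum (_ : series _ = fun=> 0); first exact: cvg_cst.
by apply/funext => n; rewrite /series/= big1.
Qed.

Lemma has_sum_sum n (u : nat -> nat -> R) (l : nat -> R) :
  (forall k, (k < n)%N -> has_sum (u k) (l k)) ->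
  has_sum (fun j => \sum_(k < n) u k j) (\sum_(k < n) l k).
Proof.
elim: n => [|n IHn] ul.
  rewrite big_ord0 (_ : (fun=> _) = fun=> 0) ?funeqE; first exact: has_sum0.
  by move=> j; rewrite big_ord0.
rewrite big_ord_recr (_ : (fun=> _) = fun j => \sum_(k < n) u k j + u n j).
  by apply: has_sumD; [apply: IHn => k kn; apply: ul; lia|exact: ul].
by apply/funext => j; rewrite big_ord_recr.
Qed.

Lemma has_sum_geometric_bounded (q M : R) (g : nat -> R) : 0 < q -> q < 1 ->
  (forall j, `|g j| <= M) ->
  exists2 l, has_sum (fun j => q ^+ j * g j) l & `|l| <= M / (1 - q).
Proof.
move=> q0 q1 gM.
have qq : `|q| < 1 by rewrite gtr0_norm.
have gq := @cvg_geometric_series R M q qq.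
have nc : cvgn [normed series (fun j => q ^+ j * g j)].
  apply: series_le_cvg (cvgP _ gq) => n.
  - exact: normr_ge0.
  - by rewrite mulr_ge0 ?exprn_ge0 ?(ltW q0)// (le_trans _ (gM 0%N)).
  - by rewrite /= normrM gtr0_norm ?exprn_gt0// mulrC ler_wpM2r ?exprn_ge0 ?(ltW q0).
exists (limn (series (fun j => q ^+ j * g j))); first exact: normed_cvg.
apply: (le_trans (lim_series_norm nc)); rewrite -(cvg_lim _ gq)//.
apply: lim_series_le => //; first exact: cvgP gq.
by move=> n /=; rewrite normrM gtr0_norm ?exprn_gt0// mulrC ler_wpM2r ?exprn_ge0 ?(ltW q0).
Qed.

End InfiniteSums.

(** * Moments of P_n: closed form, vanishing and bounds *)

Section Moments.
Variables (R : realType) (p : nat).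
Hypothesis p_gt1 : (1 < p)%N.
Let t : R := p%:R.
Let q : R := t^-1.

Let t_gt1 : 1 < t. Proof. by rewrite /t ltr1n. Qed.
Let t_gt0 : 0 < t. Proof. exact: lt_trans ltr01 t_gt1. Qed.
Let t_neq0 : t != 0. Proof. by rewrite gt_eqF. Qed.
Let q_gt0 : 0 < q. Proof. by rewrite invr_gt0. Qed.
Let q_ge0 : 0 <= q. Proof. exact: ltW. Qed.
Let q_lt1 : q < 1. Proof. by rewrite invf_lt1. Qed.
Let q_le_half : q <= 1 / 2.
Proof. by rewrite div1r lef_pV2 ?posrE// /t ler_nat. Qed.

Let onemq_neq0 k : 1 - q * q ^+ k != 0.
Proof. by rewrite subr_eq0 -exprS eq_sym lt_eqF// exprn_ilt1// ltW. Qed.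

(** The q-beta integral. Splitting off the last factor 1 - q^(j+k+1) expresses the sum for (k + 1,
    m) as the one for (k, m) minus q^(k+1) times the one for (k, m + 1); the case k = 0 is a
    geometric series. *)
Lemma q_beta_sum k m :
  has_sum (fun j => q ^+ (j * m.+1) * qpoch (q * q ^+ j) q k)
    (qpoch q q k * qpoch q q m / qpoch q q (k + m).+1).
Proof.
elim: k m => [|k IHk] m.
  rewrite qpoch0 mul1r add0n qpochS.
  have qm : `|q ^+ m.+1| < 1 by rewrite gtr0_norm ?exprn_gt0// exprn_ilt1// ltW.
  have := @cvg_geometric_series R 1 _ qm.
  rewrite (_ : geometric _ _ = fun j => q ^+ (j * m.+1) * qpoch (q * q ^+ j) q 0); last first.
    by apply/funext => j; rewrite /= qpoch0 mul1r mulr1 -exprM mulnC.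
  rewrite (_ : _ / _ = qpoch q q m / (qpoch q q m * (1 - q * q ^+ m)))//.
  have := qpochqq_neq0 R p_gt1 m 0; rewrite expr1 -/t -/q => h.
  by rewrite exprS; field; rewrite onemq_neq0 h.
have h := has_sumD (IHk m) (@has_sumZ R _ _ (- q ^+ k.+1) (IHk m.+1)).
have e : (fun j => q ^+ (j * m.+1) * qpoch (q * q ^+ j) q k +
       - q ^+ k.+1 * (q ^+ (j * m.+2) * qpoch (q * q ^+ j) q k)) =
    (fun j => q ^+ (j * m.+1) * qpoch (q * q ^+ j) q k.+1).
  by apply/funext => j; rewrite qpochS [(j * m.+2)%N]mulnS exprD exprS; ring.
rewrite e in h; move: h; congr (has_sum _ _).
have h0 := qpochqq_neq0 R p_gt1 (k + m).+2 0; rewrite expr1 -/t -/q in h0.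
have h1 := qpochqq_neq0 R p_gt1 (k + m).+1 0; rewrite expr1 -/t -/q in h1.
rewrite addnS addSn [qpoch q q k.+1]qpochS [qpoch q q m.+1]qpochS.
rewrite [qpoch q q (k + m).+2]qpochS [q ^+ (k + m).+1]exprS exprD exprS in h0 *.
move: h0 h1; rewrite mulf_eq0 negb_or => /andP[h1 h0] _.
by field; rewrite h0 h1.
Qed.

Definition legendre_moment n m : R :=
  \sum_(k < n.+1) legendre_coef R p n k * (qpoch q q k * qpoch q q m / qpoch q q (k + m).+1).

Lemma legendre_moment_sum n m :
  has_sum (fun j => q ^+ (j * m.+1) * littleqLegendre q n (q ^+ j)) (legendre_moment n m).
Proof.
rewrite (_ : (fun j => _) = fun j => \sum_(k < n.+1)
    legendre_coef R p n k * (q ^+ (j * m.+1) * qpoch (q * q ^+ j) q k)).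
  apply: (@has_sum_sum R n.+1 
    (fun k j => legendre_coef R p n k * (q ^+ (j * m.+1) * qpoch (q * q ^+ j) q k))
    (fun k => legendre_coef R p n k * (qpoch q q k * qpoch q q m / qpoch q q (k + m).+1))) => k _.
  by apply: has_sumZ; exact: q_beta_sum.
apply/funext => j; rewrite littleqLegendreE// mulr_sumr.
by apply: eq_bigr => k _; rewrite mulrCA.
Qed.

(** In base p the defining sum becomes a q-Chu-Vandermonde sum with y = q^m, A = t^(n+1), B =
    t^(m+2). *)
Lemma legendre_momentE n m : legendre_moment n m =
  (-1) ^+ n * q ^+ 'C(n.+1, 2) * qpoch (t ^+ n / t ^+ m.+1) q n / qpoch (q ^+ m.+1) q n.+1.
Proof.
have -> : qpoch (q ^+ m.+1) q n.+1 = (1 - q ^+ m.+1) *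
  ((-1) ^+ n * t ^- (m.+2 * n) * t ^- 'C(n, 2) * qpoch (t ^+ m.+2) t n).
  rewrite qpochSl -exprSr; congr (_ * _).
  by rewrite -[q ^+ m.+2]invrK -exprVn invrK qpochV ?expf_neq0// -exprM.
have m0 : 1 - q ^+ m.+1 != 0 by rewrite exprS onemq_neq0.
have tn0 := qpochtt_neq0 R p_gt1 n m.+1; rewrite -/t in tn0.
pose A := t ^+ n.+1; pose B := t ^+ m.+2.
have AB : A / B = t ^+ n / t ^+ m.+1.
  by rewrite /A /B !exprS; field; rewrite t_neq0 expf_neq0.
have cv : qdiff_sum p (q ^+ m) n (fun k => qpoch A t k / qpoch B t k) =
    qpoch (t ^+ n / t ^+ m.+1) q n / qpoch B t n.
  rewrite q_chu_vandermonde//; last first.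
  - by move=> i _; rewrite -exprD addSn expt_neq1.
  - by rewrite AB exprVn !exprS; field; rewrite t_neq0 expf_neq0.
  - by rewrite expf_neq0.
  by rewrite AB.
transitivity (t ^+ (m.+1 * n) / (1 - q ^+ m.+1) *
   qdiff_sum p (q ^+ m) n (fun k => qpoch A t k / qpoch B t k)); last first.
  rewrite cv -/B [q ^+ 'C(n.+1, 2)]exprVn binS bin1 exprD [in RHS]mulSn exprD.
  rewrite -signr_odd; case: odd; rewrite ?expr1 ?expr0;
  by field; rewrite -?exprVn ?m0 ?tn0 !expf_neq0//.
rewrite /legendre_moment /qdiff_sum mulr_sumr; apply: eq_bigr => k _.
have lekn : (k <= n)%N by rewrite -ltnS.
have l0 := qpochtt_neq0 R p_gt1 k 0; rewrite expr1 -/t in l0.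
have h1 := canRL (mulfK l0) (qbin_rising R p_gt1 n k).
rewrite /legendre_coef !natrM h1 natrX -/t -/A.
have -> : qpoch q q (k + m).+1 = qpoch q q m * (1 - q ^+ m.+1) *
    ((-1) ^+ k * t ^- (m.+2 * k) * t ^- 'C(k, 2) * qpoch (t ^+ m.+2) t k).
  rewrite addnC -addSn qpochD qpochS -exprS -exprS; congr (_ * _).
  by rewrite -[q ^+ m.+2]invrK -exprVn invrK qpochV ?expf_neq0// -exprM.
have qm0 := qpochqq_neq0 R p_gt1 m 0; rewrite expr1 -/t -/q in qm0.
have tk0 := qpochtt_neq0 R p_gt1 k m.+1; rewrite -/t in tk0.
have -> : qpoch q q k = (-1) ^+ k * t ^- k * t ^- 'C(k, 2) * qpoch t t k.
  by rewrite [LHS]qpochV.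
rewrite -exprM [q ^+ (_ * _)]exprVn binS bin1 [t ^+ (_ + _)]exprD -/B.
have -> : (m.+1 * n = m * (n - k) + (n - k) + m.+1 * k)%N.
  by rewrite -[n in LHS](subnK lekn) mulnDr mulSnr.
have -> : (m.+2 * k = m.+1 * k + k)%N by rewrite mulSn addnC.
rewrite !(exprD _ _ k) (exprD _ _ (m.+1 * k)) (exprD _ _ (n - k)).
have s0 : (-1) ^+ k != 0 :> R by rewrite signr_eq0.
move: (expf_neq0 k t_neq0) (expf_neq0 'C(k, 2) t_neq0) (expf_neq0 (m.+1 * k) t_neq0)
  (expf_neq0 (m * (n - k)) t_neq0) s0 m0 l0 qm0 tk0.
rewrite -/B.
move: (t ^+ k) (t ^+ 'C(k, 2)) (t ^+ (m.+1 * k)) (t ^+ (m * (n - k))) ((-1) ^+ k)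
  (1 - q ^+ m.+1) (qpoch t t k) (qpoch q q m) (qpoch B t k)
  (t ^+ (n - k)) ((-1) ^+ (n - k)) (t ^+ 'C(n - k, 2)) => *.
by field; do !(apply/andP; split).
Qed.

(** Orthogonality of P_n to x^m: the product (t^(n-m-1); q)_n contains the factor 1 - t^0, at index
    n - m - 1. *)
Lemma legendre_moment_lt n m : (m < n)%N -> legendre_moment n m = 0.
Proof.
move=> ltmn; rewrite legendre_momentE -expfB_cond ?(negbTE t_neq0)//.
suff -> : qpoch (t ^+ (n - m.+1)) q n = 0 by rewrite !(mul0r, mulr0).
rewrite -[n in qpoch _ _ n](subnK ltmn) qpochD exprVn divff ?expf_neq0//.
by rewrite qpochSl subrr !(mul0r, mulr0).
Qed.

(** The summand q^(n+2) strengthens the induction: with y = q^(n+2) <= 1/4 and q <= 1/2, (1/4 + y)(1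
    - y) >= 1/4 + y/2 >= 1/4 + q y. At q = 1/2 the base case is an equality. *)
Let q_poch_ge n : 1 / 4 + q ^+ n.+2 <= qpoch q q n.+1.
Proof.
have qh := q_le_half; have q0 := q_gt0.
elim: n => [|n IHn]; first by rewrite qpochS qpoch0 expr0 expr2; nra.
rewrite qpochS -exprS [q ^+ n.+3]exprS.
have y0 : 0 < q ^+ n.+2 by rewrite exprn_gt0.
have y1 : q ^+ n.+2 <= 1 / 4.
  apply: (@le_trans _ _ (q ^+ 2)); last by rewrite expr2; nra.
  by rewrite ler_wiXn2l// (ltW q_lt1).
by nra.
Qed.

Lemma qpochqq_ge n : 1 / 4 <= qpoch q q n.
Proof.
case: n => [|n]; first by rewrite qpoch0; lra.
by apply: le_trans (q_poch_ge n); rewrite lerDl exprn_ge0.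
Qed.

Lemma qpochq_le1 s n : qpoch (q ^+ s) q n <= 1.
Proof.
apply: prodr_ile1 => i _; rewrite -exprD subr_ge0 exprn_ile1 ?(ltW q_lt1)//=.
by rewrite gerBl exprn_ge0.
Qed.

Lemma qpochq_ge s n : 1 / 4 <= qpoch (q ^+ s.+1) q n.
Proof.
have := qpochqq_ge (s + n); rewrite qpochD -exprS => h.
have h1 := qpochqq_ge s; have := qpochq_le1 1 s; rewrite expr1 => h2.
have h3 : 0 <= qpoch (q ^+ s.+1) q n.
  apply: prodr_ge0 => i _; rewrite -exprD subr_ge0 exprn_ile1 ?(ltW q_lt1)//.
by nra.
Qed.

Lemma legendre_moment_bound n s : `|legendre_moment n (n + s)| <= 4 * q ^+ 'C(n.+1, 2).
Proof.
rewrite legendre_momentE !normrM normrX normrN1 expr1n [1 * _]mul1r.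
have -> : t ^+ n / t ^+ (n + s).+1 = q ^+ s.+1.
  by rewrite -addnS exprD invfM mulrA divff ?mul1r ?exprVn// expf_neq0.
rewrite normfV [X in _ * X^-1]ger0_norm; last by apply: le_trans (qpochq_ge _ _); lra.
rewrite ger0_norm ?exprn_ge0// ger0_norm; last by apply: le_trans (qpochq_ge _ _); lra.
rewrite -mulrA mulrC ler_wpM2r ?exprn_ge0//.
rewrite ler_pdivrMr; last by apply: lt_le_trans (qpochq_ge _ _); lra.
have := qpochq_ge (n + s) n.+1; have := qpochq_le1 s.+1 n; lra.
Qed.

Lemma legendre_moment_ge n : 4^-1 * q ^+ 'C(n.+1, 2) <= `|legendre_moment n n|.
Proof.
rewrite legendre_momentE !normrM normrX normrN1 expr1n [1 * _]mul1r.
have -> : t ^+ n / t ^+ n.+1 = q ^+ 1.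
  by rewrite -addn1 exprD invfM mulrA divff ?mul1r ?exprVn// expf_neq0.
rewrite normfV [X in _ * X^-1]ger0_norm; last by apply: le_trans (qpochq_ge _ _); lra.
rewrite ger0_norm ?exprn_ge0// ger0_norm; last by apply: le_trans (qpochq_ge _ _); lra.
rewrite -mulrA mulrC ler_wpM2l ?exprn_ge0//.
rewrite ler_pdivlMr; last by apply: lt_le_trans (qpochq_ge _ _); lra.
have := qpochq_ge 0 n; have := qpochq_le1 n.+1 n.+1; lra.
Qed.

End Moments.

(** p^m - 1 is the product of Phi_k(p) over k dividing m, and each such k occurs in d_n(p). *)
Lemma dvd_cyclotomic_prod (n m p : nat) : (0 < m <= n)%N ->
  exists z : int, cyclotomic_prod n p = z * ((p%:Z) ^+ m - 1).
Proof.
move=> /andP[m0 lemn].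
exists (\prod_(1 <= k < n.+1 | ~~ (k %| m)%N) ('Phi_k).[p%:Z]).
rewrite /cyclotomic_prod (bigID (fun k => k %| m)%N)/= mulrC; congr (_ * _).
have := congr1 (fun P : {poly int} => P.[p%:Z]) (prod_Cyclotomic m0).
rewrite horner_prod hornerD hornerN hornerXn hornerC => <-.
rewrite -big_filter; apply: perm_big; apply: uniq_perm.
- by rewrite filter_uniq// iota_uniq.
- exact: divisors_uniq.
move=> k; rewrite mem_filter mem_index_iota -dvdn_divisors//.
case: (boolP (k %| m)%N) => //= km; have := dvdn_leq m0 km; have := dvdn_gt0 m0 km.
by move=> -> ?; rewrite ltnS (leq_trans _ lemn).
Qed.

(** * The associated polynomial as a finite expression *)

Section AssociatedPolynomial.
Variables (R : realType) (p : nat).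
Hypothesis p_gt1 : (1 < p)%N.
Let t : R := p%:R.
Let q : R := t^-1.

Let t_gt1 : 1 < t. Proof. by rewrite /t ltr1n. Qed.
Let t_gt0 : 0 < t. Proof. exact: lt_trans ltr01 t_gt1. Qed.
Let t_neq0 : t != 0. Proof. by rewrite gt_eqF. Qed.

(** Telescoping: x is replaced by y in one factor at a time, and the factor of index i changes by -
    r^(i+1) (x - y). *)
Lemma qpoch_sub (r x y : R) k : qpoch (r * x) r k - qpoch (r * y) r k =
  - (x - y) * \sum_(i < k) r ^+ i.+1 * qpoch (r * y) r i * qpoch (r ^+ i.+2 * x) r (k - i.+1).
Proof.
elim: k => [|k IHk]; first by rewrite big_ord0 !qpoch0 subrr mulr0.
rewrite big_ord_recr/= subnn qpoch0 mulr1.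
rewrite (eq_bigr (fun i : 'I_k => (r ^+ i.+1 * qpoch (r * y) r i *
   qpoch (r ^+ i.+2 * x) r (k - i.+1)) * (1 - r ^+ k.+1 * x))); last first.
  move=> i _; have ik := ltn_ord i.
  rewrite (_ : k.+1 - i.+1 = (k - i.+1).+1)%N; last by lia.
  rewrite qpochS !mulrA (mulrAC _ x) -exprD; congr (_ * (_ - _ ^+ _ * _)); lia.
rewrite -mulr_suml mulrDr mulrA -IHk !qpochS exprS; ring.
Qed.

(** The denominators come from [q_beta_sum] with m = 0: the sum of q^j (q^(j+1); q)_i over j is 1 /
    (1 - q^(i+1)), and q^(i+1) times this is 1 / (t^(i+1) - 1). *)
Definition legendre_assoc_expansion n (x : R) : R :=
  - \sum_(k < n.+1) legendre_coef R p n k *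
      \sum_(i < k) qpoch (q ^+ i.+2 * x) q (k - i.+1) / (t ^+ i.+1 - 1).

Lemma littleqLegendre_assoc_sum n x : (forall j, x != q ^+ j) ->
  has_sum (fun j => (littleqLegendre q n x - littleqLegendre q n (q ^+ j)) / (x - q ^+ j) * q ^+ j)
    (legendre_assoc_expansion n x).
Proof.
move=> xq.
rewrite (_ : (fun=> _) = fun j => -1 * \sum_(k < n.+1) legendre_coef R p n k *
   \sum_(i < k) (q ^+ i.+1 * qpoch (q ^+ i.+2 * x) q (k - i.+1)) *
     (q ^+ (j * 1) * qpoch (q * q ^+ j) q i)).
  rewrite /legendre_assoc_expansion -[X in has_sum _ X]mulN1r; apply: has_sumZ.
  apply: (@has_sum_sum R n.+1 (fun k j => legendre_coef R p n k *
   \sum_(i < k) (q ^+ i.+1 * qpoch (q ^+ i.+2 * x) q (k - i.+1)) *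
     (q ^+ (j * 1) * qpoch (q * q ^+ j) q i)) (fun k => legendre_coef R p n k *
      \sum_(i < k) qpoch (q ^+ i.+2 * x) q (k - i.+1) / (t ^+ i.+1 - 1))) => k _.
  apply: has_sumZ.
  apply: (@has_sum_sum R k (fun i j => (q ^+ i.+1 * qpoch (q ^+ i.+2 * x) q (k - i.+1)) *
     (q ^+ (j * 1) * qpoch (q * q ^+ j) q i))
     (fun i => qpoch (q ^+ i.+2 * x) q (k - i.+1) / (t ^+ i.+1 - 1))) => i _.
  have -> : qpoch (q ^+ i.+2 * x) q (k - i.+1) / (t ^+ i.+1 - 1) =
     (q ^+ i.+1 * qpoch (q ^+ i.+2 * x) q (k - i.+1)) *
     (qpoch q q i * qpoch q q 0 / qpoch q q (i + 0).+1).
    rewrite qpoch0 mulr1 addn0 qpochS -exprS ![q ^+ i.+1]exprVn.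
    have qi0 := qpochqq_neq0 R p_gt1 i 0; rewrite expr1 -/t -/q in qi0.
    have e1 := expt_neq1 R p_gt1 i; rewrite -/t -subr_eq0 in e1.
    have ti := expf_neq0 i.+1 t_neq0.
    move: e1 ti qi0; move: (t ^+ i.+1) (qpoch q q i) => T Q e1 ti qi0.
    by field; rewrite ti qi0 e1.
  by apply: has_sumZ; exact: q_beta_sum.
apply/funext => j; rewrite !littleqLegendreE//.
have xj : x - q ^+ j != 0 by rewrite subr_eq0.
rewrite -[LHS]mulrA [X in X * _ = _](_ : _ = -1 * (x - q ^+ j) * \sum_(k < n.+1) legendre_coef R p n k *
   \sum_(i < k) (q ^+ i.+1 * qpoch (q ^+ i.+2 * x) q (k - i.+1)) * qpoch (q * q ^+ j) q i).
  set S := \sum_(k < n.+1) _.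
  rewrite (_ : -1 * _ * _ * _ = -1 * (S * q ^+ j)); last by field.
  congr (_ * _); rewrite /S {S}.
  rewrite [RHS](eq_bigr (fun k : 'I_n.+1 => q ^+ j * (legendre_coef R p n k *
   \sum_(i < k) (q ^+ i.+1 * qpoch (q ^+ i.+2 * x) q (k - i.+1)) * qpoch (q * q ^+ j) q i))).
    by rewrite -mulr_sumr mulrC.
  move=> k _; rewrite mulrCA; congr (_ * _); rewrite mulr_sumr; apply: eq_bigr => i _.
  by rewrite muln1 mulrCA.
rewrite -sumrB mulN1r mulr_sumr; apply: eq_bigr => k _.
rewrite -mulrBr qpoch_sub mulrCA; congr (_ * (_ * _)).
by apply: eq_bigr => i _; rewrite mulrAC.
Qed.

Lemma littleqLegendre_assocE n x : (forall j, x != q ^+ j) ->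
  littleqLegendre_assoc q n x = legendre_assoc_expansion n x.
Proof. by move=> xq; apply: has_sum_lim; exact: littleqLegendre_assoc_sum. Qed.

Lemma littleqLegendre0 x : littleqLegendre q 0 x = 1.
Proof. by rewrite /littleqLegendre big_ord1 !qpoch0 !expr0 !mulr1 divr1. Qed.

(** The case n = 0 stands apart because the point c p^0 can then be the node 1. *)
Lemma littleqLegendre_assoc0 x : littleqLegendre_assoc q 0 x = 0.
Proof.
apply: has_sum_lim; rewrite (_ : (fun=> _) = fun=> 0); first exact: has_sum0.
by apply/funext => j; rewrite !littleqLegendre0 subrr !mul0r.
Qed.

End AssociatedPolynomial.

(** * Integrality of a_n and b_n *)

Section Integrality.
Variables (R : realType) (p : nat) (a b : int).
Hypotheses (p_gt1 : (1 < p)%N) (b_neq0 : b != 0).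
Let t : R := p%:R.
Let q : R := t^-1.
Let c : R := a%:~R / b%:~R.
Hypothesis c_neq : forall k : nat, (1 <= k)%N -> c * t ^+ k != 1.

Let t_gt1 : 1 < t. Proof. by rewrite /t ltr1n. Qed.
Let t_neq0 : t != 0. Proof. by rewrite gt_eqF// (lt_trans ltr01). Qed.
Let b_neq0R : b%:~R != 0 :> R. Proof. by rewrite intr_eq0. Qed.

Lemma shifted_neq_qpow n j : (0 < n)%N -> c * t ^+ n != q ^+ j.
Proof.
move=> n0; rewrite exprVn; apply/eqP => h.
have := @c_neq (n + j)%N; rewrite exprD mulrA h mulVf ?expf_neq0// eqxx.
by move=> /(_ _)/negP; apply => //; lia.
Qed.

Let intM (x y : R) : x \is a Num.int -> y \is a Num.int -> x * y \is a Num.int.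
Proof. exact: rpredM. Qed.

Let b_int k : b%:~R ^+ k \is a @Num.int R.
Proof. by apply: rpredX; exact: intr_int. Qed.

Lemma int_factor k : b%:~R * (1 - c * t ^+ k) \is a Num.int.
Proof.
have -> : b%:~R * (1 - c * t ^+ k) = b%:~R - a%:~R * t ^+ k by rewrite /c; field.
apply: rpredB; first exact: intr_int.
by apply: intM; [exact: intr_int|rewrite /t -natrX; exact: natr_int].
Qed.

(** The factors are 1 - c t^(n-j-i) with i < k; the hypothesis keeps these exponents nonnegative, so
    one b clears each factor. *)
Lemma int_qpoch n j k : (j + k <= n.+1)%N ->
  b%:~R ^+ k * qpoch (c * t ^+ n / t ^+ j) q k \is a Num.int.
Proof.
elim: k => [|k IHk] jk; first by rewrite expr0 qpoch0 mulr1.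
rewrite qpochS exprSr mulrACA; apply: intM; first by apply: IHk; lia.
rewrite exprVn -mulrA -invfM -exprD -mulrA -expfB_cond ?(negbTE t_neq0); last by lia.
exact: int_factor.
Qed.

Lemma int_qpoch_pow m n j k : (j + k <= n.+1)%N -> (k <= m)%N ->
  b%:~R ^+ m * qpoch (c * t ^+ n / t ^+ j) q k \is a Num.int.
Proof.
by move=> jk km; rewrite -(subnK km) exprD -mulrA; apply: intM => //; exact: int_qpoch.
Qed.

Lemma legendre_coef_int n k : legendre_coef R p n k \is a Num.int.
Proof. by apply: intM; [apply: rpredX; rewrite rpredN; exact: rpred1|exact: natr_int]. Qed.

Lemma littleqLegendre_int n : b%:~R ^+ n * littleqLegendre q n (c * t ^+ n) \is a Num.int.
Proof.
rewrite littleqLegendreE// mulr_sumr; apply: rpred_sum => k _.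
rewrite mulrCA; apply: intM; first exact: legendre_coef_int.
by rewrite [_ * (c * _)]mulrC -[t in _ / t]expr1 int_qpoch_pow// -1?ltnS// add1n.
Qed.

Lemma littleqLegendre_assoc_int n :
  b%:~R ^+ n * (cyclotomic_prod n p)%:~R * littleqLegendre_assoc q n (c * t ^+ n) \is a Num.int.
Proof.
case: n => [|n]; first by rewrite littleqLegendre_assoc0// mulr0.
rewrite littleqLegendre_assocE//; last by move=> j; exact: shifted_neq_qpow.
rewrite /legendre_assoc_expansion mulrN rpredN mulr_sumr; apply: rpred_sum => k _.
rewrite mulrCA; apply: intM; first exact: legendre_coef_int.
rewrite mulr_sumr; apply: rpred_sum => i _.
have ik := ltn_ord i; have kn := ltn_ord k.
have [|z ->] := @dvd_cyclotomic_prod n.+1 i.+1 p; first lia.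
rewrite rmorphM rmorphB rmorph1/= rmorphXn/= -/t.
have e1 := expt_neq1 R p_gt1 i; rewrite -/t -subr_eq0 in e1.
rewrite [X in X \in _](_ : _ = (b%:~R ^+ n.+1 * qpoch (c * t ^+ n.+1 / t ^+ i.+2) q (k - i.+1)) * z%:~R).
  by apply: intM; [apply: int_qpoch_pow; lia|exact: intr_int].
by rewrite [_ / t ^+ _]mulrC -exprVn -/q; field.
Qed.

Lemma qpoch_int m n : b%:~R ^+ n * qpoch (c * t ^+ m) t n \is a Num.int.
Proof.
elim: n => [|n IHn]; first by rewrite expr0 qpoch0 mulr1.
by rewrite qpochS exprSr mulrACA -[c * t ^+ m * _]mulrA -exprD; apply: intM => //; exact: int_factor.
Qed.

(** The factor 1 - c t^k of (c;t)_n cancels the denominator of the k-th term. This is why (c;p)_n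
    enters the definition of a_n and b_n. *)
Lemma qpoch_div_int n k : (0 < k < n)%N ->
  b%:~R ^+ n * qpoch c t n * lambert_term c p k \is a Num.int.
Proof.
move=> /andP[k0 kn]; have k1 := c_neq k0; rewrite -subr_eq0 in k1.
rewrite -(subnK kn) addnC qpochD qpochS exprD exprSr -/t /lambert_term.
have -> : b%:~R ^+ k * b%:~R * b%:~R ^+ (n - k.+1) * (qpoch c t k * (1 - c * t ^+ k) *
   qpoch (c * t ^+ k.+1) t (n - k.+1)) * (1 / (c * t ^+ k - 1)) =
  - (b%:~R ^+ k * qpoch c t k) * b%:~R * (b%:~R ^+ (n - k.+1) * qpoch (c * t ^+ k.+1) t (n - k.+1)).
  by move: (qpoch _ _ (n - _)) (_ ^+ (n - _)) => *; field.
apply: intM; last exact: qpoch_int.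
apply: intM; last exact: intr_int.
by rewrite rpredN; have := qpoch_int 0 k; rewrite mulr1.
Qed.

(** Of the 2n factors b, n clear (c;p)_n and n clear P_n or Q_n. *)
Lemma approx_int n : approx_num R p a b n \is a Num.int /\ approx_den R p a b n \is a Num.int.
Proof.
have den : approx_den R p a b n = (b%:~R ^+ n * qpoch c t n) * (cyclotomic_prod n p)%:~R *
    (b%:~R ^+ n * littleqLegendre q n (c * t ^+ n)).
  rewrite /approx_den -/c -/t -/q mul2n -addnn exprD; ring.
have qint : b%:~R ^+ n * qpoch c t n \is a Num.int.
  by have := qpoch_int 0 n; rewrite mulr1.
split; last first.
  rewrite den; apply: intM; last exact: littleqLegendre_int.
  by apply: intM => //; exact: intr_int.
apply: rpredD.
  rewrite -/c -/t -/q mul2n -addnn exprD.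
  rewrite (_ : _ * _ = (b%:~R ^+ n * qpoch c t n) *
    (b%:~R ^+ n * (cyclotomic_prod n p)%:~R * littleqLegendre_assoc q n (c * t ^+ n))); last ring.
  by apply: intM => //; exact: littleqLegendre_assoc_int.
rewrite -/c mulr_sumr big_seq; apply: rpred_sum => k; rewrite mem_index_iota => kn.
rewrite den (_ : _ * lambert_term c p k = (b%:~R ^+ n * qpoch c t n * lambert_term c p k) *
  (cyclotomic_prod n p)%:~R * (b%:~R ^+ n * littleqLegendre q n (c * t ^+ n))); last ring.
apply: intM; last exact: littleqLegendre_int.
by apply: intM; [exact: qpoch_div_int|exact: intr_int].
Qed.

End Integrality.

Lemma le_of_le_add_geometric (R : realType) (u v K : R) :
  (forall N : nat, u <= v + K * (2^-1) ^+ N) -> u <= v.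
Proof.
move=> h.
have g : (fun N : nat => v + K * (2^-1) ^+ N) @ \oo --> v.
  rewrite -[X in _ --> X]addr0; apply: cvgD; first exact: cvg_cst.
  apply: (@cvg_geometric R K 2^-1).
  by rewrite ger0_norm ?invr_ge0// invf_lt1 ?ltr1n.
rewrite -(cvg_lim _ g)//; apply: limr_ge; first exact: cvgP g.
exact: nearW.
Qed.

(** * Two-sided bound for the remainder R_n *)

Section Remainder.
Variables (R : realType) (p : nat).
Hypothesis p_gt1 : (1 < p)%N.
Let t : R := p%:R.
Let q : R := t^-1.

Let t_gt1 : 1 < t. Proof. by rewrite /t ltr1n. Qed.
Let t_gt0 : 0 < t. Proof. exact: lt_trans ltr01 t_gt1. Qed.
Let t_neq0 : t != 0. Proof. by rewrite gt_eqF. Qed.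
Let q_gt0 : 0 < q. Proof. by rewrite invr_gt0. Qed.
Let q_ge0 : 0 <= q. Proof. exact: ltW. Qed.
Let q_lt1 : q < 1. Proof. by rewrite invf_lt1. Qed.

Lemma littleqLegendre_qpow_bound n j :
  `|littleqLegendre q n (q ^+ j)| <= \sum_(k < n.+1) `|legendre_coef R p n k|.
Proof.
rewrite littleqLegendreE//; apply: (le_trans (ler_norm_sum _ _ _)).
apply: ler_sum => k _; rewrite normrM ler_piMr//.
rewrite -/t -/q -exprS ger0_norm ?(@qpochq_le1 R p p_gt1 j.+1 k)//.
by apply: le_trans (qpochq_ge R p_gt1 j k); lra.
Qed.

(** With F_M = sum_j q^(j(M+1)) P_n(q^j) / (x - q^j), vanishing of the lower moments gives x^(n+1) r
    = S_n + F_(n+1). Here Y/4 <= |S_n| <= 4 Y, and 64 is large enough to force |F_(n+1)| <= Y/8,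
    half of the lower bound. *)
Lemma legendre_remainder_bound n x r : 64 <= `|x| ->
  has_sum (fun j => littleqLegendre q n (q ^+ j) * (q ^+ j / (x - q ^+ j))) r ->
  8^-1 * q ^+ 'C(n.+1, 2) <= `|x| ^+ n.+1 * `|r| <= 5 * q ^+ 'C(n.+1, 2).
Proof.
move=> x64 hr; set Y := q ^+ 'C(n.+1, 2).
have Y0 : 0 < Y by rewrite exprn_gt0.
set C := \sum_(k < n.+1) `|legendre_coef R p n k|.
have qj1 j : q ^+ j <= 1 by rewrite exprn_ile1// ltW.
have xq j : 1 <= `|x - q ^+ j|.
  have := ler_distD 0 x (q ^+ j); rewrite subr0 sub0r normrN.
  have := lerB_normD x (- q ^+ j).
  by rewrite normrN (ger0_norm (exprn_ge0 j q_ge0)) => h _; have := qj1 j; lra.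
have xq0 j : x - q ^+ j != 0 by rewrite -normr_gt0; apply: lt_le_trans (xq j).
have /choice[F hF] : forall M, exists l, has_sum (fun j => q ^+ j *
    (q ^+ (j * M) * (littleqLegendre q n (q ^+ j) / (x - q ^+ j)))) l /\ `|l| <= C / (1 - q).
  move=> M.
  have [|l h1 h2] := @has_sum_geometric_bounded R q C
    (fun j => q ^+ (j * M) * (littleqLegendre q n (q ^+ j) / (x - q ^+ j))) q_gt0 q_lt1.
    move=> j; rewrite !normrM normfV ger0_norm ?exprn_ge0//.
    have h1 := qj1 (j * M)%N; have h2 := littleqLegendre_qpow_bound n j.
    have h3 : `|x - q ^+ j|^-1 <= 1 by rewrite invf_le1// (lt_le_trans _ (xq j)).
    have h4 : 0 <= `|x - q ^+ j|^-1 by rewrite invr_ge0.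
    have h5 := normr_ge0 (littleqLegendre q n (q ^+ j)).
    apply: (@le_trans _ _ (`|littleqLegendre q n (q ^+ j)| / `|x - q ^+ j|)).
      by rewrite ler_piMl// mulr_ge0.
    by apply: le_trans h2; rewrite ler_piMr.
  by exists l.
have rE : r = F 0%N.
  apply: (has_sum_unique hr); have [h _] := hF 0%N; move: h; congr has_sum.
  by apply/funext => j; rewrite muln0 expr0; ring.
(* From x / (x - q^j) = 1 + q^j / (x - q^j). *)
have rec M : x * F M = legendre_moment R p n M + F M.+1.
  apply: (@has_sum_unique R (fun j => x * (q ^+ j * (q ^+ (j * M) *
     (littleqLegendre q n (q ^+ j) / (x - q ^+ j)))))).
    by apply: has_sumZ; exact: (hF M).1.
  have := has_sumD (@legendre_moment_sum R p p_gt1 n M) (hF M.+1).1; congr has_sum.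
  apply/funext => j; rewrite -/t -/q !mulnS !exprD; have := xq0 j.
  by move: (q ^+ (j * M)) (q ^+ j) (littleqLegendre _ _ _) => A B D h; field.
have powF m : (m <= n)%N -> x ^+ m * F 0%N = F m.
  elim: m => [|m IHm] mn; first by rewrite expr0 mul1r.
  rewrite exprSr mulrAC IHm; last exact: ltnW.
  by rewrite mulrC rec legendre_moment_lt// add0r.
have step s K : 0 <= K -> `|F (n + s).+1| <= 4 * Y + K -> `|F (n + s)%N| <= 8^-1 * Y + 64^-1 * K.
  move=> K0 h; have := congr1 Num.norm (rec (n + s)%N); rewrite normrM => e.
  have := ler_normD (legendre_moment R p n (n + s)) (F (n + s).+1); rewrite -e => h1.
  have := @legendre_moment_bound R p p_gt1 n s; rewrite -/t -/q -/Y => h2.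
  by have := normr_ge0 (F (n + s)%N); nra.
pose K := C / (1 - q).
have K0 : 0 <= K by apply: le_trans (hF 0%N).2.
(* The recursion is used downwards: K depends on n in an uncontrolled way but not on the index of F,
   and each step back divides its contribution by at least 2. *)
have bnd N s : `|F (n + s)%N| <= 4 * Y + K * 2^-1 ^+ N.
  elim: N s => [|N IHN] s; first by rewrite expr0 mulr1; have := (hF (n + s)%N).2; rewrite -/K; lra.
  have k0 : 0 <= K * 2^-1 ^+ N by rewrite mulr_ge0// exprn_ge0// invr_ge0.
  have := IHN s.+1; rewrite addnS => /(step _ _ k0); rewrite exprS; lra.
have bF s : `|F (n + s)%N| <= 4 * Y by apply: (@le_of_le_add_geometric R _ _ K) => N; exact: bnd.
have b1 : `|F n.+1| <= 8^-1 * Y.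
  have h : `|F (n + 1).+1| <= 4 * Y + 0 by rewrite addr0 -addnS; exact: bF.
  by have := step _ _ (lexx 0) h; rewrite mulr0 addr0 addn1.
have e : `|x| ^+ n.+1 * `|r| = `|legendre_moment R p n n + F n.+1|.
  by rewrite -rec -normrX -normrM rE exprS -mulrA powF.
have m1 := @legendre_moment_ge R p p_gt1 n; rewrite -/t -/q -/Y in m1.
have m2 := @legendre_moment_bound R p p_gt1 n 0; rewrite addn0 -/t -/q -/Y in m2.
have n1 := ler_normD (legendre_moment R p n n) (F n.+1).
have n2 := lerB_normD (legendre_moment R p n n) (F n.+1).
rewrite e; apply/andP; split; lra.
Qed.

End Remainder.

(** * The series L: its tail as a sum over the nodes q^j *)

Section LambertSeries.
Variables (R : realType) (p : nat) (c : R).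
Hypothesis p_gt1 : (1 < p)%N.
Let t : R := p%:R.
Let q : R := t^-1.

Let t_gt1 : 1 < t. Proof. by rewrite /t ltr1n. Qed.
Let t_gt0 : 0 < t. Proof. exact: lt_trans ltr01 t_gt1. Qed.
Let t_neq0 : t != 0. Proof. by rewrite gt_eqF. Qed.
Let q_gt0 : 0 < q. Proof. by rewrite invr_gt0. Qed.
Let q_lt1 : q < 1. Proof. by rewrite invf_lt1. Qed.

Lemma lambert_tail_sum x : x != 0 -> exists T, has_sum (fun j => q ^+ j / (x - q ^+ j)) T.
Proof.
move=> x0.
have qc : (fun j => q ^+ j) @ \oo --> (0 : R).
  by apply: cvg_expr; rewrite ger0_norm// ltW.
have gc : (fun j => (x - q ^+ j)^-1) @ \oo --> (x - 0)^-1.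
  by apply: cvgV; [rewrite subr0|apply: cvgB => //; exact: cvg_cst].
have [M [_ hM]] := cvg_seq_bounded (cvgP _ gc).
have [l h _] := @has_sum_geometric_bounded R q (M + 1) (fun j => (x - q ^+ j)^-1) q_gt0 q_lt1
  (fun j => hM (M + 1) (ltac:(by rewrite ltrDl)) j I).
by exists l.
Qed.

(** This identity is the reason for evaluating P_n and Q_n at c p^n. *)
Lemma lambert_term_shift n j :
  lambert_term c p (j + n) = q ^+ j / (c * t ^+ n - q ^+ j).
Proof.
rewrite /lambert_term exprD -/t exprVn.
have tj : t ^+ j != 0 by rewrite expf_neq0.
have -> : c * (t ^+ j * t ^+ n) - 1 = t ^+ j * (c * t ^+ n - t ^- j) by field.
by rewrite invfM mul1r.
Qed.

Lemma lambert_sum_cvg n T : (0 < n)%N ->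
  has_sum (fun j => q ^+ j / (c * t ^+ n - q ^+ j)) T ->
  (fun N : nat => \sum_(1 <= k < N) lambert_term c p k) @ \oo -->
    \sum_(1 <= k < n) lambert_term c p k + T.
Proof.
move=> n0 hT; rewrite -(cvg_shiftn n).
rewrite (_ : [sequence _]_n = fun N => \sum_(1 <= k < n) lambert_term c p k +
   series (fun j => q ^+ j / (c * t ^+ n - q ^+ j)) N).
  by apply: cvgD => //; exact: cvg_cst.
apply/funext => N /=; rewrite (@big_cat_nat _ _ _ n)//=; last exact: leq_addl.
congr (_ + _); rewrite -[n in LHS]add0n big_addn addnK /series/=.
by apply: eq_bigr => j _; rewrite lambert_term_shift.
Qed.

End LambertSeries.

(** * Quadratic asymptotics and averages over n/k *)

Section QuadraticGrowth.
Variable R : realType.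
Implicit Types (D : nat -> R) (l : R).

(** With [cvg_of_quadratic_bound], the limit is restated as a bound valid for every n, small ones
    included, so that it can be applied to all the floors n/k at once. *)
Lemma quadratic_bound D l : (fun n => D n / n%:R ^+ 2) @ \oo --> l ->
  forall e : R, 0 < e -> exists2 K : R, 0 <= K & forall n, `|D n - l * n%:R ^+ 2| <= e * n%:R ^+ 2 + K.
Proof.
move=> /cvgrPdist_le Dl e e0; have [N _ hN] := Dl _ e0.
exists (\sum_(i < N.+1) `|D i - l * i%:R ^+ 2|); first exact: sumr_ge0.
move=> n; case: (leqP n N) => [lenN|ltNn].
  apply: ler_wpDl; first by rewrite mulr_ge0 ?exprn_ge0// ltW.
  by rewrite (bigD1 (Ordinal (lenN : n < N.+1)%N))//= lerDl sumr_ge0.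
apply: ler_wpDr; first exact: sumr_ge0.
have n0 : 0 < n%:R ^+ 2 :> R by rewrite exprn_gt0// ltr0n; lia.
have := hN n (ltnW ltNn); rewrite /= distrC => h.
rewrite -ler_pdivrMr//; apply: le_trans h.
by rewrite -[X in _ / X](gtr0_norm n0) -normf_div mulrBl mulfK ?gt_eqF.
Qed.

Lemma cvg_of_quadratic_bound D l :
  (forall e : R, 0 < e -> exists2 K : R, 0 <= K & forall n, `|D n - l * n%:R ^+ 2| <= e * n%:R ^+ 2 + K) ->
  (fun n => D n / n%:R ^+ 2) @ \oo --> l.
Proof.
move=> h; apply/cvgrPdist_le => e e0.
have [K K0 hK] := h _ (divr_gt0 e0 (ltr0n R 2)).
exists (Num.truncn (2 * K / e)).+1 => //= n /= nK.
have n1 : (1 <= n)%N by lia.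
have n1R : 1 <= n%:R :> R by rewrite ler1n.
have nK' : 2 * K / e < n%:R.
  by apply: lt_le_trans (truncnS_gt _) _; rewrite ler_nat.
have n0 : 0 < n%:R ^+ 2 :> R by rewrite exprn_gt0// ltr0n.
rewrite distrC (_ : _ - _ = (D n - l * n%:R ^+ 2) / n%:R ^+ 2); last by field; rewrite gt_eqF// ltr0n.
rewrite normf_div [X in _ / X]gtr0_norm// ler_pdivrMr//; apply: (le_trans (hK n)).
have : 2 * K < e * n%:R by rewrite [e * _]mulrC -ltr_pdivrMr.
rewrite expr2; nra.
Qed.

(* The average of D over N, N/2, N/3, ... determines D because
   sum_(k >= 2) 1/k^2 <= 3/4 < 1 makes the passage from a quadratic bound on
   the terms k >= 2 to a bound on D N a contraction. *)
Lemma floor_average_contraction D :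
  (exists C : R, forall n, `|D n| <= C * n%:R ^+ 2) ->
  (forall e : R, 0 < e -> exists2 K : R, 0 <= K &
     forall n, `|\sum_(1 <= k < n.+1) D (n %/ k)%N| <= e * n%:R ^+ 2 + K) ->
  (fun n => D n / n%:R ^+ 2) @ \oo --> (0 : R).
Proof.
move=> [C hC] avg.
pose good (th : R) := exists2 K : R, 0 <= K & forall n, `|D n| <= th * n%:R ^+ 2 + K.
have inv2 n : \sum_(2 <= k < n.+1) (k%:R ^+ 2)^-1 <= 3 / 4 :> R.
  case: n => [|[|n]]; [by rewrite big_geq//; lra|by rewrite big_geq//; lra|].
  case: n => [|n]; first by rewrite big_nat1; lra.
  (* 1/4 from k = 2; after it 1/k^2 <= 1/(k-1) - 1/k telescopes. *)
  suff h m : \sum_(2 <= k < m.+4) (k%:R ^+ 2)^-1 <= 3 / 4 - m.+3%:R^-1 :> R.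
    by apply: le_trans (h _) _; rewrite gerBl invr_ge0.
  elim: m => [|m IHm]; first by rewrite big_nat_recr//= big_nat1; lra.
  rewrite big_nat_recr//=; apply: le_trans (lerD IHm (lexx _)) _.
  rewrite -[m.+4]addn4 -[m.+3]addn3 !natrD; have : 0 <= m%:R :> R by [].
  move: (m%:R : R) => x x0; rewrite -subr_ge0.
  rewrite (_ : _ - _ = ((x + 3) * (x + 4) ^+ 2)^-1); last by field; lra.
  by rewrite invr_ge0 mulr_ge0 ?exprn_ge0//; lra.
(* 7/8 = 3/4 + 1/16 + 1/16: the terms k >= 2, the average, and the absorption of the additive
   constants K, which sum to at most K n. *)
have half th : 0 < th -> good th -> good (7 / 8 * th).
  move=> th0 [K K0 hK]; have th16 : 0 < th / 16 by lra.
  have [K1 K10 hK1] := avg _ th16.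
  exists (K1 + 4 * K ^+ 2 / th); first by rewrite addr_ge0// divr_ge0 ?mulr_ge0 ?exprn_ge0// ltW.
  case=> [|n].
    have := hC 0%N; rewrite expr0n/= !mulr0 => h; rewrite (le_trans h)// add0r.
    by rewrite addr_ge0// divr_ge0 ?mulr_ge0 ?exprn_ge0// ltW.
  have := hK1 n.+1; rewrite big_ltn// divn1; set S := \sum_(_ <= k < _) _ => h.
  have hS : `|S| <= 3 / 4 * th * n.+1%:R ^+ 2 + K * n.+1%:R.
    apply: (le_trans (ler_norm_sum _ _ _)).
    apply: (@le_trans _ _ (\sum_(2 <= k < n.+2) (th * n.+1%:R ^+ 2 * (k%:R ^+ 2)^-1 + K))).
      rewrite !big_nat; apply: ler_sum => k /andP[k2 kn].
      apply: (le_trans (hK _)); rewrite lerD2r -mulrA ler_wpM2l ?(ltW th0)//.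
      rewrite -expr_div_n ler_pXn2r ?nnegrE ?divr_ge0//.
      by rewrite ler_pdivlMr ?ltr0n -?natrM ?ler_nat ?leq_trunc_div//; lia.
    rewrite big_split/= -mulr_sumr sumr_const_nat lerD//.
      rewrite mulrC mulrA ler_wpM2r ?exprn_ge0//.
      by rewrite ler_wpM2r ?(ltW th0).
    by rewrite -[K *+ _]mulr_natr ler_wpM2l// ler_nat; lia.
  have : `|D n.+1| <= th / 16 * n.+1%:R ^+ 2 + K1 + (3 / 4 * th * n.+1%:R ^+ 2 + K * n.+1%:R).
    have := ler_normB (D n.+1 + S) S; rewrite addrK => h2.
    by apply: (le_trans h2); apply: lerD.
  move=> h1; apply: (le_trans h1).
  (* AM-GM: K n <= th n^2 / 16 + 4 K^2 / th *)
  have : K * n.+1%:R <= th / 16 * n.+1%:R ^+ 2 + 4 * K ^+ 2 / th.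
    rewrite -subr_ge0 (_ : _ - _ = (th * n.+1%:R / 4 - 2 * K) ^+ 2 / th); last by field; lra.
    by rewrite divr_ge0 ?sqr_ge0// ltW.
  lra.
have C1 : 0 < `|C| + 1 by have := normr_ge0 C; lra.
have goodX j : good ((7 / 8) ^+ j * (`|C| + 1)).
  elim: j => [|j IHj]; last first.
    by rewrite exprS -mulrA; apply: half => //; rewrite mulr_gt0// exprn_gt0//; lra.
  exists 0 => // n; rewrite expr0 mul1r addr0; apply: (le_trans (hC n)).
  rewrite ler_wpM2r ?exprn_ge0//; have := ler_norm C; lra.
apply: cvg_of_quadratic_bound => e e0.
have g : (fun j : nat => (`|C| + 1) * (7 / 8) ^+ j) @ \oo --> (0 : R).
  by apply: (@cvg_geometric R); rewrite ger0_norm; lra.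
move/cvgr0Pnorm_le : g => /(_ _ e0)[j _ /(_ j (leqnn j)) hj].
have [K K0 hK] := goodX j; exists K => // n; rewrite mul0r subr0.
apply: (le_trans (hK n)); rewrite lerD2r ler_wpM2r ?exprn_ge0//.
by rewrite mulrC; apply: le_trans hj; exact: ler_norm.
Qed.

Lemma cvg_invn_nat : (fun n : nat => n%:R^-1) @ \oo --> (0 : R).
Proof.
rewrite -(cvg_shiftn 1) (_ : [sequence _]_n = harmonic); first exact: cvg_harmonic.
by apply/funext => n /=; rewrite addn1.
Qed.

(** A floor y of z satisfies z^2 - 2 z <= y^2 <= z^2. The total error, divided by n^2, is at most
    2/n times the harmonic sum, a Cesaro mean of a null sequence. *)
Lemma floor_square_average Z : series (fun k : nat => (k.+1%:R ^+ 2)^-1) @ \oo --> (Z : R) ->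
  (fun n => (\sum_(1 <= k < n.+1) (n %/ k)%:R ^+ 2) / n%:R ^+ 2) @ \oo --> (Z : R).
Proof.
move=> hZ; have hm := cesaro (@cvg_harmonic R).
apply: (@squeeze_cvgr _ _ _ _ (fun n => series (fun k : nat => (k.+1%:R ^+ 2)^-1) n
    - 2 * (n%:R^-1 * series harmonic n)) (series (fun k : nat => (k.+1%:R ^+ 2)^-1))) => //; last first.
  rewrite -[X in _ --> X]subr0; apply: cvgB => //.
  rewrite -[X in _ --> X](mulr0 2); apply: cvgM; first exact: cvg_cst.
  rewrite -(cvg_shiftn 1) (_ : [sequence _]_n = arithmetic_mean harmonic)//.
  by apply/funext => m /=; rewrite addn1.
exists 1%N => // n /= n1.
have n0 : 0 < n%:R :> R by rewrite ltr0n.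
rewrite big_add1/= /series/= mulr_suml !mulr_sumr -sumrB.
apply/andP; split; apply: ler_sum => k _; have k0 : 0 < k.+1%:R :> R by rewrite ltr0n.
  have := ltn_ceil n (ltn0Sn k); rewrite -(ltr_nat R) natrM -natr1 => h.
  have {h} : n%:R / k.+1%:R < (n %/ k.+1)%:R + 1 :> R by rewrite ltr_pdivrMr.
  have y0 : 0 <= (n %/ k.+1)%:R :> R by [].
  have z0 : 0 <= n%:R / k.+1%:R :> R by rewrite divr_ge0.
  rewrite -subr_ge0 (_ : _ - _ = ((n %/ k.+1)%:R ^+ 2 - (n%:R / k.+1%:R) ^+ 2
     + 2 * (n%:R / k.+1%:R)) / n%:R ^+ 2); last by field; rewrite !gt_eqF.
  move: y0 z0; move: (_ / k.+1%:R) (_ %:R) => z y y0 z0 zy.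
  by rewrite divr_ge0 ?exprn_ge0//; case: (lerP z 2) => ?; nra.
have := leq_trunc_div n k.+1; rewrite -(ler_nat R) natrM -ler_pdivlMr// => h.
rewrite ler_pdivrMr ?exprn_gt0// mulrC -expr_div_n.
by rewrite ler_pXn2r ?nnegrE ?divr_ge0.
Qed.

End QuadraticGrowth.

(** * Growth of d_n(p) *)

Section CyclotomicProduct.
Variables (R : realType) (p : nat).
Hypothesis p_gt1 : (1 < p)%N.
Let t : R := p%:R.
Let lt : R := ln t.

Let t_gt1 : 1 < t. Proof. by rewrite /t ltr1n. Qed.
Let t_gt0 : 0 < t. Proof. exact: lt_trans ltr01 t_gt1. Qed.
Let lt_gt0 : 0 < lt. Proof. by rewrite ln_gt0. Qed.

Lemma ln_prod (I : Type) (r : seq I) (P : pred I) (F : I -> R) :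
  (forall i, P i -> 0 < F i) -> ln (\prod_(i <- r | P i) F i) = \sum_(i <- r | P i) ln (F i).
Proof.
move=> F0; elim: r => [|i r IHr]; first by rewrite !big_nil ln1.
rewrite !big_cons; case: ifP => // Pi.
by rewrite lnM ?IHr// posrE ?F0// prodr_gt0.
Qed.

Lemma cyclotomic_at_neq0 k : (0 < k)%N -> ('Phi_k).[p%:Z] != 0.
Proof.
move=> k0; have := congr1 (fun P : {poly int} => P.[p%:Z]) (prod_Cyclotomic k0).
rewrite horner_prod hornerD hornerN hornerXn hornerC => h.
have : (p%:Z) ^+ k - 1 != 0.
  by rewrite subr_eq0 -[1]/(1%:Z) -rmorphXn/= eqz_nat -[1%N](exp1n k) eqn_exp2r// gtn_eqF.
rewrite -h prodf_seq_neq0 => /allP/(_ k); rewrite -dvdn_divisors// => /(_ (dvdnn k)).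
exact.
Qed.

Let f (k : nat) : R := ln `|('Phi_k).[p%:Z]%:~R|.

Let absPhi_ge1 k : (0 < k)%N -> 1 <= `|('Phi_k).[p%:Z]%:~R : R|.
Proof. by move=> k0; rewrite -intr_norm ler1z -gtz0_ge1 normr_gt0 cyclotomic_at_neq0. Qed.

Let f_ge0 k : (0 < k)%N -> 0 <= f k.
Proof. by move=> k0; rewrite ln_ge0// absPhi_ge1. Qed.

Lemma ln_cyclotomic_prod n : ln `|(cyclotomic_prod n p)%:~R : R| = \sum_(1 <= k < n.+1) f k.
Proof.
rewrite /cyclotomic_prod rmorph_prod/= normr_prod !big_nat ln_prod// => k /andP[k0 _].
by apply: lt_le_trans (absPhi_ge1 k0).
Qed.

Lemma sum_divisors_ln_cyclotomic m : (0 < m)%N ->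
  \sum_(1 <= d < m.+1 | (d %| m)%N) f d = ln (t ^+ m - 1).
Proof.
move=> m0; rewrite -big_filter (perm_big (divisors m)); last first.
  apply: uniq_perm; rewrite ?filter_uniq ?iota_uniq ?divisors_uniq// => k.
  rewrite mem_filter mem_index_iota -dvdn_divisors//.
  case: (boolP (k %| m)%N) => //= km.
  by rewrite (dvdn_gt0 m0 km) ltnS dvdn_leq.
rewrite big_seq -ln_prod; last first.
  move=> d; rewrite -dvdn_divisors// => dm.
  by apply: lt_le_trans (absPhi_ge1 (dvdn_gt0 m0 dm)).
rewrite -big_seq -normr_prod -(rmorph_prod (intmul 1)) -horner_prod prod_Cyclotomic//.
rewrite hornerD hornerN hornerXn hornerC rmorphB rmorphXn/= -/t gtr0_norm//.
by rewrite subr_gt0 exprn_egt1// -lt0n.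
Qed.

(** The analogue of the Chebyshev identity for log n!: on both sides log |Phi_d(p)| is counted
    floor(n/d) times, once for each multiple of d up to n. *)
Lemma sum_floor_ln_cyclotomic n :
  \sum_(1 <= k < n.+1) ln `|(cyclotomic_prod (n %/ k) p)%:~R : R| =
  \sum_(1 <= m < n.+1) ln (t ^+ m - 1).
Proof.
transitivity (\sum_(1 <= d < n.+1) f d *+ (n %/ d)).
  transitivity (\sum_(1 <= k < n.+1) \sum_(1 <= d < n.+1) f d *+ (d * k <= n)%N).
    rewrite !big_nat; apply: eq_bigr => k /andP[k0 kn].
    rewrite ln_cyclotomic_prod [RHS](big_cat_nat (n := (n %/ k).+1) _ _)//=; last first.
      by rewrite ltnS leq_div.
    rewrite [X in _ = _ + X]big_nat [X in _ = _ + X]big1 ?addr0; last first.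
      by move=> d /andP[kd _]; rewrite -leq_divRL// leqNgt kd.
    rewrite !big_nat; apply: eq_bigr => d /andP[_ dk].
    by rewrite -leq_divRL// -ltnS dk.
  rewrite exchange_big/=; rewrite !big_nat; apply: eq_bigr => d /andP[d0 dn].
  rewrite sumrMnr; congr (_ *+ _).
  rewrite (big_cat_nat (n := (n %/ d).+1) _ _)//=; last by rewrite ltnS leq_div.
  rewrite [X in (_ + X)%N = _]big_nat [X in (_ + X)%N = _]big1 ?addn0; last first.
    by move=> k /andP[dk _]; rewrite mulnC -leq_divRL// leqNgt dk.
  rewrite big_nat (eq_bigr (fun=> 1%N)); last first.
    by move=> k /andP[_ kd]; rewrite mulnC -leq_divRL// -ltnS kd.
  by rewrite -big_nat sum_nat_const_nat subn1 muln1.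
transitivity (\sum_(1 <= m < n.+1) \sum_(1 <= d < n.+1) f d *+ (d %| m)%N).
  rewrite exchange_big/=; apply: eq_bigr => d _.
  by rewrite sumrMnr divn_count_dvd.
rewrite !big_nat; apply: eq_bigr => m /andP[m0 mn].
rewrite -sum_divisors_ln_cyclotomic// (big_cat_nat (n := m.+1) _ _)//=.
rewrite [X in _ + X = _]big_nat [X in _ + X = _]big1 ?addr0; last first.
  by move=> d /andP[md _]; rewrite gtnNdvd.
by rewrite [RHS]big_mkcond; apply: eq_bigr => d _; rewrite mulrb.
Qed.

Lemma ln_exptB1 m : (0 < m)%N -> m%:R * lt - ln 2 <= ln (t ^+ m - 1) <= m%:R * lt.
Proof.
move=> m0.
have tm : 2 <= t ^+ m.
  apply: (@le_trans _ _ t); first by rewrite /t ler_nat.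
  by rewrite -[X in X <= _]expr1 ler_weXn2l// ltW.
have e : ln (t ^+ m) = m%:R * lt by rewrite lnXn// mulr_natl.
rewrite -e -lnV ?posrE// -lnM ?posrE ?invr_gt0 ?exprn_gt0//.
apply/andP; split; rewrite ler_ln ?posrE; lra.
Qed.

Lemma sum_ln_exptB1_cvg :
  (fun n => (\sum_(1 <= m < n.+1) ln (t ^+ m - 1)) / n%:R ^+ 2) @ \oo --> lt / 2.
Proof.
have ic := @cvg_invn_nat R.
have sumn n : \sum_(1 <= m < n.+1) (m%:R : R) = n%:R * (n%:R + 1) / 2.
  elim: n => [|n IHn]; first by rewrite big_geq// mul0r mul0r.
  by rewrite big_nat_recr//= IHn -natr1; field.
apply: (@squeeze_cvgr _ _ _ _ (fun n => lt / 2 + (lt / 2 - ln 2) * n%:R^-1)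
    (fun n => lt / 2 + lt / 2 * n%:R^-1)); last 2 first.
- rewrite -[X in _ --> X]addr0; apply: cvgD; first exact: cvg_cst.
  by rewrite -[X in _ --> X](mulr0 (lt / 2 - ln 2)); apply: cvgM => //; exact: cvg_cst.
- rewrite -[X in _ --> X]addr0; apply: cvgD; first exact: cvg_cst.
  by rewrite -[X in _ --> X](mulr0 (lt / 2)); apply: cvgM => //; exact: cvg_cst.
exists 1%N => // n /= n1; have n0 : 0 < n%:R :> R by rewrite ltr0n.
have n2 : 0 < n%:R ^+ 2 :> R by rewrite exprn_gt0.
rewrite ler_pdivlMr// ler_pdivrMr//; apply/andP; split.
  rewrite [X in X <= _](_ : _ = \sum_(1 <= m < n.+1) (m%:R * lt - ln 2)).
    by rewrite !big_nat; apply: ler_sum => m /andP[m0 _]; have /andP[] := ln_exptB1 m0.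
  rewrite sumrB -mulr_suml sumn sumr_const_nat subn1 -mulr_natr/=; field; lra.
rewrite [X in _ <= X](_ : _ = \sum_(1 <= m < n.+1) (m%:R * lt)).
  by rewrite !big_nat; apply: ler_sum => m /andP[m0 _]; have /andP[] := ln_exptB1 m0.
by rewrite -mulr_suml sumn; field; lra.
Qed.

(** The constant kap is the one for which the averages of log d_n(p) and of kap n^2 have the same
    leading term: lt / 2 = kap Z. Their difference then falls under [floor_average_contraction]; its
    quadratic a priori bound comes from keeping only the term k = 1 of the average. *)
Lemma ln_cyclotomic_prod_cvg Z : 0 < Z ->
  series (fun k : nat => (k.+1%:R ^+ 2)^-1) @ \oo --> (Z : R) ->
  (fun n => ln `|(cyclotomic_prod n p)%:~R : R| / n%:R ^+ 2) @ \oo --> lt / (2 * Z).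
Proof.
move=> Z0 hZ; pose S n : R := ln `|(cyclotomic_prod n p)%:~R|; set kap := lt / (2 * Z).
have kap0 : 0 < kap by rewrite divr_gt0// mulr_gt0.
have S0 n : 0 <= S n.
  by rewrite /S ln_cyclotomic_prod big_nat sumr_ge0// => k /andP[k0 _]; exact: f_ge0.
pose D n := S n - kap * n%:R ^+ 2.
suff hD : (fun n => D n / n%:R ^+ 2) @ \oo --> (0 : R).
  apply: cvg_of_quadratic_bound => e e0.
  have [K K0 hK] := quadratic_bound hD e0; exists K => // n.
  by have := hK n; rewrite mul0r subr0.
apply: floor_average_contraction.
  exists (lt + kap) => n.
  have Sle : S n <= lt * n%:R ^+ 2.
    case: n => [|n]; first by rewrite /S ln_cyclotomic_prod big_geq// expr0n/= mulr0.
    apply: (@le_trans _ _ (\sum_(1 <= k < n.+2) S (n.+1 %/ k)%N)).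
      by rewrite big_ltn// divn1 lerDl sumr_ge0.
    rewrite sum_floor_ln_cyclotomic; apply: (@le_trans _ _ (\sum_(1 <= m < n.+2) (lt * n.+1%:R))).
      rewrite !big_nat; apply: ler_sum => m /andP[m0 mn].
      have /andP[_ h] := ln_exptB1 m0; apply: (le_trans h).
      by rewrite mulrC ler_wpM2l ?ler_nat// ltW.
    by rewrite sumr_const_nat subn1 -[X in X <= _]mulr_natr expr2 mulrA.
  have n2 : 0 <= n%:R ^+ 2 :> R by rewrite exprn_ge0.
  have Sn := S0 n.
  by rewrite ler_norml /D; apply/andP; split; nra.
have h0 : (fun n => (\sum_(1 <= k < n.+1) D (n %/ k)%N) / n%:R ^+ 2) @ \oo --> (0 : R).
  rewrite (_ : (fun _ => _) = (fun n => (\sum_(1 <= m < n.+1) ln (t ^+ m - 1)) / n%:R ^+ 2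
     - kap * ((\sum_(1 <= k < n.+1) (n %/ k)%:R ^+ 2) / n%:R ^+ 2))).
    rewrite [X in _ --> X](_ : 0 = lt / 2 - kap * Z); last by rewrite /kap; field; rewrite gt_eqF.
    apply: cvgB; first exact: sum_ln_exptB1_cvg.
    by apply: cvgM; [exact: cvg_cst|exact: floor_square_average].
  apply/funext => n; rewrite sumrB -mulr_sumr mulrBl [in RHS]mulrA; congr (_ / _ - _).
  exact: sum_floor_ln_cyclotomic.
move=> e e0; have [K K0 hK] := quadratic_bound h0 e0; exists K => // n.
by have := hK n; rewrite mul0r subr0.
Qed.

End CyclotomicProduct.

(** * The sum of 1/k^2 *)

Section Basel.
Variable R : realType.
Implicit Types x : R.

Lemma cvg_extraction (u : nat -> R) (l : R) (phi : nat -> nat) :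
  (forall n, (n <= phi n)%N) -> u @ \oo --> l -> (fun n => u (phi n)) @ \oo --> l.
Proof.
move=> hphi /cvgrPdist_le ul; apply/cvgrPdist_le => e e0.
have [N _ hN] := ul _ e0; exists N => // n Nn; apply: hN => /=.
by apply: leq_trans (hphi n).
Qed.

Lemma sin_ltx x : 0 < x -> x < pi / 2 -> sin x < x.
Proof.
move=> x0 xpi.
have [c] := @MVT R sin cos 0 x x0 (fun c _ => is_derive_sin c)
  (continuous_subspaceT (@continuous_sin R)).
rewrite in_itv/= => /andP[c0 cx]; rewrite sin0 !subr0 => ->.
rewrite gtr_pMl//; rewrite lt_neqAle cos_le1 andbT; apply/negP => /eqP h.
have := @cos2Dsin2 R c; rewrite h expr1n => e.
have : 0 < sin c ^+ 2 by rewrite exprn_gt0// sin_gt0_pihalf// c0 (lt_trans cx).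
lra.
Qed.

Lemma ltx_tan x : 0 < x -> x < pi / 2 -> x < tan x.
Proof.
move=> x0 xpi.
have cc c : 0 <= c -> c <= x -> 0 < cos c.
  move=> c0 cx; apply: cos_gt0_pihalf; rewrite (le_lt_trans cx xpi) andbT.
  by apply: lt_le_trans c0; rewrite oppr_lt0 divr_gt0// pi_gt0.
have [||c] := @MVT R tan (fun c => (cos c) ^- 2) 0 x x0.
- move=> c; rewrite in_itv/= => /andP[c0 cx]; apply: is_derive_tan.
  by rewrite gt_eqF// cc// ltW.
- apply: continuous_in_subspaceT => c; rewrite inE/= in_itv/= => /andP[c0 cx].
  by apply: continuous_tan; rewrite gt_eqF// cc.
rewrite in_itv/= => /andP[c0 cx]; rewrite tan0 !subr0 => ->.
have cpos : 0 < cos c by rewrite cc// ltW.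
rewrite ltr_pMl// invf_gt1 ?exprn_gt0// lt_neqAle.
rewrite exprn_ile1 ?cos_le1 ?ltW// andbT; apply/negP => /eqP h.
have := @cos2Dsin2 R c; rewrite h => e.
have : 0 < sin c ^+ 2 by rewrite exprn_gt0// sin_gt0_pihalf// c0 (lt_trans cx).
lra.
Qed.

(** From sin x < x < tan x and 1/sin^2 = 1 + 1/tan^2. *)
Lemma inv_sqr_sin_bound x : 0 < x -> x < pi / 2 ->
  (x ^+ 2)^-1 <= (sin x ^+ 2)^-1 <= 1 + (x ^+ 2)^-1.
Proof.
move=> x0 xpi; have s0 : 0 < sin x by rewrite sin_gt0_pihalf// x0.
have c0 : 0 < cos x.
  by apply: cos_gt0_pihalf; rewrite xpi andbT (lt_trans _ x0)// oppr_lt0 divr_gt0// pi_gt0.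
have sx := sin_ltx x0 xpi; have xt := ltx_tan x0 xpi.
have h1 : (sin x ^+ 2)^-1 = 1 + (tan x ^+ 2)^-1.
  have := @cos2Dsin2 R x; rewrite /tan expr_div_n invf_div => h.
  have s2 : sin x ^+ 2 != 0 by rewrite gt_eqF// exprn_gt0.
  by rewrite -[1](divff s2) -mulrDl addrC h mul1r.
apply/andP; split.
  by rewrite lef_pV2 ?posrE ?exprn_gt0// ler_pXn2r ?nnegrE ?ltW.
rewrite h1 lerD2l lef_pV2 ?posrE ?exprn_gt0//; last exact: lt_trans xt.
by rewrite ler_pXn2r ?nnegrE ?ltW// (lt_trans x0 xt).
Qed.

(** For k < 2^n these lie in (0, pi/2). The nodes of level n + 1 form pairs y, pi/2 - y, and
    doubling the smaller member of each pair gives the nodes of level n. *)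
Let node n k : R := (k.*2.+1)%:R * pi / (2 ^ n.+2)%:R.

Let node_gt0 n k : 0 < node n k.
Proof. by rewrite /node divr_gt0 ?mulr_gt0 ?pi_gt0// ltr0n expn_gt0. Qed.

Let node_lt n k : (k < 2 ^ n)%N -> node n k < pi / 2.
Proof.
move=> kn; rewrite /node ltr_pdivrMr ?ltr0n ?expn_gt0// mulrC -mulrA ltr_pM2l ?pi_gt0//.
by rewrite ltr_pdivlMl// -natrM ltr_nat !expnS; lia.
Qed.

(* 1/sin^2 x = (1/sin^2 (x/2) + 1/cos^2 (x/2)) / 4 *)
Lemma sum_inv_sqr_sin n : \sum_(0 <= k < 2 ^ n) (sin (node n k) ^+ 2)^-1 = 2 * 4 ^+ n.
Proof.
elim: n => [|n IHn].
  rewrite expn0 big_nat1 expr0 mulr1 /node double0 mul1r.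
  have e1 : cos (pi / 4 *+ 2) = 0 :> R.
    by rewrite -[RHS](@cos_pihalf R); congr cos; rewrite -mulr_natr; field.
  have e2 := @cos2Dsin2 R (pi / 4); rewrite cos_mulr2n in e1.
  have -> : sin (pi / (2 ^ 2)%:R) ^+ 2 = 1 / 2 :> R by rewrite (_ : (2 ^ 2)%:R = 4)//; lra.
  by field.
rewrite exprS mulrCA -IHn mulr_sumr.
have nE : (2 ^ n.+1 = 2 ^ n + 2 ^ n)%N by rewrite expnS mul2n addnn.
rewrite (big_cat_nat (n := (2 ^ n)%N)) ?nE ?leq_addr//=.
(* The second half of the sum is read backwards, so that its k-th node is pi/2 minus the k-th node
   of the first half. *)
rewrite -{2}[(2 ^ n)%N]add0n big_addn addnK [X in _ + X = _]big_nat_rev/=.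
rewrite -big_split !big_nat; apply: eq_bigr => k /andP[_ kn] /=.
set y := node n.+1 k.
have k2n : (k < 2 ^ n.+1)%N by rewrite nE; lia.
have y0 : 0 < y by exact: node_gt0.
have ypi : y < pi / 2 by exact: node_lt.
have s0 : 0 < sin y by rewrite sin_gt0_pihalf// y0.
have c0 : 0 < cos y.
  by apply: cos_gt0_pihalf; rewrite ypi andbT (lt_trans _ y0)// oppr_lt0 divr_gt0// pi_gt0.
have p2 : (2 ^ n)%:R != 0 :> R by rewrite pnatr_eq0 expn_eq0.
have -> : node n.+1 (0 + 2 ^ n - k.+1 + 2 ^ n) = pi / 2 - y.
  rewrite /y /node (_ : (0 + 2 ^ n - k.+1 + 2 ^ n).*2.+1 = 2 ^ n.+2 - k.*2.+1)%N; last first.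
    by rewrite !expnS; lia.
  rewrite natrB; last by rewrite !expnS; lia.
  by rewrite !expnS !natrM; field.
have -> : node n k = y *+ 2.
  by rewrite /y /node -mulr_natr !expnS !natrM; field.
rewrite sin_mulr2n sinB cos_pihalf sin_pihalf mul1r mul0r subr0 -mulr_natr.
have := @cos2Dsin2 R y => e; rewrite -[in LHS](mulr1 (sin y ^- 2)) -[in LHS](mulr1 (cos y ^- 2)) -e.
by field; rewrite !gt_eqF.
Qed.

Let odd_sum n : R := \sum_(0 <= k < n) ((k.*2.+1)%:R ^+ 2)^-1.

(** Summing [inv_sqr_sin_bound] over the 2^n nodes puts the sum of 1/node^2 between 2 4^n - 2^n and
    2 4^n; dividing by 16 4^n / pi^2 gives the claim. *)
Lemma odd_sum_bound n :
  pi ^+ 2 / 8 - pi ^+ 2 / 16 * (2^-1) ^+ n <= odd_sum (2 ^ n) <= pi ^+ 2 / 8.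
Proof.
have p0 : 0 < 2 ^+ n :> R by rewrite exprn_gt0.
have pi0 := @pi_gt0 R.
have e : \sum_(0 <= k < 2 ^ n) (node n k ^+ 2)^-1 = odd_sum (2 ^ n) * (16 * 4 ^+ n / pi ^+ 2).
  rewrite /odd_sum mulr_suml; apply: eq_bigr => k _; rewrite /node.
  have k0 : (k.*2.+1)%:R != 0 :> R by rewrite pnatr_eq0.
  rewrite !expnS !natrM natrX (_ : 4 ^+ n = (2 ^+ n) ^+ 2 :> R); last first.
    by rewrite -exprM mulnC exprM; congr (_ ^+ _); ring.
  have p1 : 2 ^+ n != 0 :> R by rewrite gt_eqF.
  have pi1 : pi != 0 :> R by rewrite gt_eqF.
  move: k0 p1 pi1; move: (k.*2.+1%:R) (2 ^+ n) (pi : R) => x T y x0 T0 y0.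
  by field; do !(apply/andP; split).
have h1 : \sum_(0 <= k < 2 ^ n) (node n k ^+ 2)^-1 <= 2 * 4 ^+ n.
  rewrite -sum_inv_sqr_sin !big_nat; apply: ler_sum => k /andP[_ kn].
  by have /andP[] := inv_sqr_sin_bound (node_gt0 n k) (node_lt kn).
have h2 : 2 * 4 ^+ n <= 2 ^+ n + \sum_(0 <= k < 2 ^ n) (node n k ^+ 2)^-1.
  have -> : 2 ^+ n = \sum_(0 <= k < 2 ^ n) (1 : R) by rewrite sumr_const_nat subn0 natrX.
  rewrite -big_split -sum_inv_sqr_sin !big_nat; apply: ler_sum => k /andP[_ kn].
  by have /andP[] := inv_sqr_sin_bound (node_gt0 n k) (node_lt kn).
have f4 : 4 ^+ n = (2 ^+ n) ^+ 2 :> R.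
  by rewrite -exprM mulnC exprM; congr (_ ^+ _); ring.
rewrite e f4 in h1 h2; rewrite exprVn.
move: h1 h2 p0 pi0; set O := odd_sum _; move: (2 ^+ n) (pi : R) => T P h1 h2 p0 P0.
have T1 : T != 0 by rewrite gt_eqF.
have P1 : P != 0 by rewrite gt_eqF.
have c0 : 0 <= P ^+ 2 / (16 * T ^+ 2) by rewrite divr_ge0 ?mulr_ge0 ?exprn_ge0// ltW.
apply/andP; split.
  have := ler_wpM2r c0 h2.
  rewrite (_ : 2 * _ * _ = P ^+ 2 / 8); last by field.
  rewrite (_ : (T + _) * _ = O + P ^+ 2 / 16 / T); last by field; do !(apply/andP; split).
  by rewrite lerBlDr.
have := ler_wpM2r c0 h1.
rewrite (_ : O * _ * _ = O); last by field; do !(apply/andP; split).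
by rewrite (_ : 2 * _ * _ = P ^+ 2 / 8); last by field.
Qed.

Lemma basel : series (fun k : nat => (k.+1%:R ^+ 2)^-1) @ \oo --> (pi ^+ 2 / 6 : R).
Proof.
set u := series _.
have ub n : u n.+1 <= 2 - n.+1%:R^-1.
  elim: n => [|n IHn]; first by rewrite /u /series/= big_nat1 expr1n invr1; lra.
  rewrite /u /series/= big_nat_recr//=; apply: le_trans (lerD IHn (lexx _)) _.
  rewrite -[n.+2]addn2 -[n.+1]addn1 !natrD; have : 0 <= n%:R :> R by [].
  move: (n%:R : R) => x x0; rewrite -subr_ge0.
  rewrite (_ : _ - _ = ((x + 1) * (x + 2) ^+ 2)^-1); last by field; lra.
  by rewrite invr_ge0 mulr_ge0 ?exprn_ge0//; lra.
have cu : cvgn u.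
  apply: nondecreasing_is_cvgn.
    apply/nondecreasing_seqP => n; rewrite /u /series/= big_nat_recr//= lerDl invr_ge0.
    by rewrite exprn_ge0.
  exists 2 => _ [n _ <-]; case: n => [|n]; first by rewrite /u /series/= big_geq.
  by apply: le_trans (ub n) _; rewrite gerBl invr_ge0.
(* Removing the even terms leaves 3/4 of the full sum in the limit, hence pi^2/6 from pi^2/8. *)
have oE n : odd_sum n = u n.*2 - u n / 4.
  elim: n => [|n IHn]; first by rewrite /odd_sum /u /series/= !big_geq// mul0r subrr.
  rewrite /odd_sum big_nat_recr//= -/(odd_sum n) IHn /u /series/= doubleS !big_nat_recr//=.
  have -> : n.*2.+2%:R = 2 * n.+1%:R :> R by rewrite -natrM; congr (_%:R); lia.
  have n0 : n.+1%:R != 0 :> R by rewrite pnatr_eq0.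
  have n1 : (n.*2.+1)%:R != 0 :> R by rewrite pnatr_eq0.
  by move: n0 n1; move: (n.+1%:R) (n.*2.+1%:R) => x y x0 y0; field; rewrite x0 y0.
set l := limn u in cu *.
have ul : u @ \oo --> l by exact: cu.
have h1 : (fun n => odd_sum (2 ^ n)) @ \oo --> l - l / 4.
  rewrite (_ : (fun n => _) = (fun n => u (2 ^ n).*2 - u (2 ^ n)%N / 4)); last first.
    by apply/funext => n; rewrite oE.
  apply: cvgB; last apply: cvgM; last exact: cvg_cst.
  - by apply: (cvg_extraction (phi := fun n => (2 ^ n).*2)) => // n; have := ltn_expl n (ltnSn 1); lia.
  - by apply: (cvg_extraction (phi := fun n => (2 ^ n)%N)) => // n; exact/ltnW/ltn_expl.
have h2 : (fun n => odd_sum (2 ^ n)) @ \oo --> pi ^+ 2 / 8.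
  apply: (@squeeze_cvgr _ _ _ _ (fun n => pi ^+ 2 / 8 - pi ^+ 2 / 16 * (2^-1) ^+ n) (fun=> pi ^+ 2 / 8)).
  - by apply: nearW => n; exact: odd_sum_bound.
  - rewrite -[X in _ --> X]subr0; apply: cvgB; first exact: cvg_cst.
    by apply: (@cvg_geometric R); rewrite ger0_norm ?invr_ge0// invf_lt1 ?ltr1n.
  - exact: cvg_cst.
have e : l - l / 4 = pi ^+ 2 / 8 by apply: cvg_unique h1 h2.
by rewrite (_ : pi ^+ 2 / 6 = l)//; lra.
Qed.

End Basel.

(** * Decimals of pi and of the exponent *)

Section PiBounds.
Variable R : realType.

Lemma cos_coeff'S (x : R) i :
  cos_coeff' x i.+1 = - (cos_coeff' x i * (x ^+ 2 / (i.*2.+1 * i.*2.+2)%:R)).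
Proof.
rewrite /cos_coeff' -!exprnP doubleS !factS !natrM exprS mulN1r.
have f0 : (i.*2)`!%:R != 0 :> R by rewrite pnatr_eq0 gtn_eqF// fact_gt0.
have h1 : i.*2.+1%:R != 0 :> R by rewrite pnatr_eq0.
have h2 : i.*2.+2%:R != 0 :> R by rewrite pnatr_eq0.
rewrite -[in x ^+ i.*2.+2]addn2 [x ^+ (_ + _)]exprD.
move: f0 h1 h2; move: ((i.*2)`!%:R) (i.*2.+1%:R) (i.*2.+2%:R) ((-1) ^+ i) (x ^+ i.*2) => A B C D E *.
by field; do !(apply/andP; split).
Qed.

Let cos_coeff'0 (x : R) : cos_coeff' x 0 = 1.
Proof. by rewrite /cos_coeff' double0 fact0 expr0 expr0z mul1r divff. Qed.

(** From n = 1 on the cosine terms decrease in absolute value: consecutive ones have ratio x^2 /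
    ((2n+1)(2n+2)) <= x^2 / 12 < 1. *)
Let pair_gt0 (x : R) n : 0 < x -> x ^+ 2 < 12 -> (0 < n)%N ->
  0 < (-1) ^+ n * (cos_coeff' x n + cos_coeff' x n.+1).
Proof.
move=> x0 x12 n0; rewrite cos_coeff'S.
have -> : (-1) ^+ n * (cos_coeff' x n - cos_coeff' x n * (x ^+ 2 / (n.*2.+1 * n.*2.+2)%:R)) =
   x ^+ n.*2 / (n.*2)`!%:R * (1 - x ^+ 2 / (n.*2.+1 * n.*2.+2)%:R).
  rewrite -{1}[cos_coeff' x n]mulr1 -mulrBr mulrA; congr (_ * _).
  by rewrite /cos_coeff' -exprnP !mulrA -exprD addnn -signr_odd odd_double expr0 mul1r.
rewrite mulr_gt0 ?divr_gt0 ?exprn_gt0 ?ltr0n ?fact_gt0//.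
rewrite subr_gt0 ltr_pdivrMr ?ltr0n// mul1r; apply: (lt_le_trans x12).
by rewrite ler_nat; nia.
Qed.

Lemma cos_gt_partial_sum (x : R) m : 0 < x -> x ^+ 2 < 12 -> (0 < m)%N ->
  \sum_(0 <= i < m.*2) cos_coeff' x i < cos x.
Proof.
move=> x0 x12 m0; have h := @cvg_cos_coeff' R x.
rewrite -(cvg_lim (@Rhausdorff R) h); apply: lt_sum_lim_series; first exact: cvgP h.
move=> d; have := @pair_gt0 x (m.*2 + d.*2) x0 x12.
rewrite -signr_odd oddD !odd_double expr0 mul1r addnS; apply; lia.
Qed.

Lemma cos_lt_partial_sum (x : R) m : 0 < x -> x ^+ 2 < 12 ->
  cos x < \sum_(0 <= i < m.*2.+1) cos_coeff' x i.
Proof.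
move=> x0 x12; have := @cvg_cos_coeff' R x => /cvgN h.
rewrite -ltrN2 -(cvg_lim (@Rhausdorff R) h) -sumrN -seriesN.
apply: lt_sum_lim_series; first by rewrite seriesN; exact: cvgP h.
move=> d; have := @pair_gt0 x (m.*2.+1 + d.*2) x0 x12.
rewrite -signr_odd oddD /= !odd_double expr1 mulN1r opprD addnS; apply; lia.
Qed.

Lemma lt_pihalf (x : R) : 0 <= x <= 2 -> 0 < cos x -> x < pi / 2.
Proof.
move=> /andP[x0 x2]; rewrite -(@cos_pihalf R) ltr_cos// in_itv/=.
  by have := @pi_ge2 R; lra.
by have := @pi_ge2 R; lra.
Qed.

Lemma gt_pihalf (x : R) : 0 <= x <= 2 -> cos x < 0 -> pi / 2 < x.
Proof.
move=> /andP[x0 x2]; rewrite -(@cos_pihalf R) ltr_cos// in_itv/=.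
  by have := @pi_ge2 R; lra.
by have := @pi_ge2 R; lra.
Qed.

Lemma cos_gt_taylor14 (x : R) : 0 < x -> x ^+ 2 < 12 ->
  1 - x ^+ 2 / 2 * (1 - x ^+ 2 / 12 * (1 - x ^+ 2 / 30 * (1 - x ^+ 2 / 56 *
    (1 - x ^+ 2 / 90 * (1 - x ^+ 2 / 132 * (1 - x ^+ 2 / 182)))))) < cos x.
Proof.
move=> x0 x12; apply: le_lt_trans (@cos_gt_partial_sum _ 4%N x0 x12 isT).
rewrite (_ : 4.*2 = 8)%N// !big_nat_recr//= big_geq// !cos_coeff'S.
rewrite !cos_coeff'0.
rewrite (_ : (0.*2.+1 * 0.*2.+2 = 2)%N)// (_ : (1.*2.+1 * 1.*2.+2 = 12)%N)// (_ : (2.*2.+1 * 2.*2.+2 = 30)%N)// (_ : (3.*2.+1 * 3.*2.+2 = 56)%N)// (_ : (4.*2.+1 * 4.*2.+2 = 90)%N)// (_ : (5.*2.+1 * 5.*2.+2 = 132)%N)//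
  (_ : (6.*2.+1 * 6.*2.+2 = 182)%N)//.
by move: (x ^+ 2) => z; rewrite le_eqVlt; apply/orP; left; apply/eqP; field.
Qed.

Lemma cos_lt_taylor12 (x : R) : 0 < x -> x ^+ 2 < 12 ->
  cos x < 1 - x ^+ 2 / 2 * (1 - x ^+ 2 / 12 * (1 - x ^+ 2 / 30 * (1 - x ^+ 2 / 56 *
    (1 - x ^+ 2 / 90 * (1 - x ^+ 2 / 132))))).
Proof.
move=> x0 x12; apply: lt_le_trans (@cos_lt_partial_sum _ 3%N x0 x12) _.
rewrite (_ : 3.*2.+1 = 7)%N// !big_nat_recr//= big_geq// !cos_coeff'S !cos_coeff'0.
rewrite (_ : (0.*2.+1 * 0.*2.+2 = 2)%N)// (_ : (1.*2.+1 * 1.*2.+2 = 12)%N)// (_ : (2.*2.+1 * 2.*2.+2 = 30)%N)// (_ : (3.*2.+1 * 3.*2.+2 = 56)%N)// (_ : (4.*2.+1 * 4.*2.+2 = 90)%N)// (_ : (5.*2.+1 * 5.*2.+2 = 132)%N)//.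
by move: (x ^+ 2) => z; rewrite le_eqVlt; apply/orP; left; apply/eqP; field.
Qed.

Lemma pi_gt_3141592 : 3 + 141 / 10 ^+ 3 + 592 / 10 ^+ 6 < pi :> R.
Proof.
suff : (3 + 141 / 10 ^+ 3 + 592 / 10 ^+ 6) / 2 < pi / 2 :> R by lra.
apply: lt_pihalf; first by lra.
apply: le_lt_trans (cos_gt_taylor14 _ _); lra.
Qed.

Lemma pi_lt_31415927 : pi < 3 + 141 / 10 ^+ 3 + 592 / 10 ^+ 6 + 7 / 10 ^+ 7 :> R.
Proof.
suff : pi / 2 < (3 + 141 / 10 ^+ 3 + 592 / 10 ^+ 6 + 7 / 10 ^+ 7) / 2 :> R by lra.
apply: gt_pihalf; first by lra.
apply: lt_le_trans (cos_lt_taylor12 _ _) _; lra.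
Qed.

(** 3 z / (z - 3) decreases in z. The value is 4.3101191..., about 10^-7 above the lower bound,
    which is why pi is bounded from above to seven decimals. *)
Lemma irrationality_exponent_bounds :
  (4 + 310 / 10 ^+ 3 + 119 / 10 ^+ 6 <= 3 * pi ^+ 2 / (pi ^+ 2 - 3) :> R)
  /\ (3 * pi ^+ 2 / (pi ^+ 2 - 3) < 4 + 310 / 10 ^+ 3 + 120 / 10 ^+ 6 :> R).
Proof.
have sqr_lt (x y : R) : 0 < x -> x < y -> x ^+ 2 < y ^+ 2.
  by move=> x0 xy; rewrite ltr_pXn2r// nnegrE ltW// (lt_trans x0).
have a0 : 0 < 3 + 141 / 10 ^+ 3 + 592 / 10 ^+ 6 :> R by lra.
have l := sqr_lt _ _ a0 pi_gt_3141592.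
have u := sqr_lt _ _ (@pi_gt0 R) pi_lt_31415927.
move: l u; move: (pi ^+ 2 : R) => z l u.
have z3 : 0 < z - 3 by lra.
split; first by rewrite (ler_pdivlMr _ _ z3); lra.
by rewrite (ltr_pdivrMr _ _ z3); lra.
Qed.

End PiBounds.

(** * From linear forms to irrationality and its measure *)

(** Expanding leaves g m^2 <= 2 P m + P + K <= (3 P + K) m. *)
Lemma quadratic_gap_bound (R : realType) (P K g m : R) : 0 < P -> 0 <= K -> 0 < g -> 1 <= m ->
  (P + g) * m ^+ 2 <= K + P * (m + 1) ^+ 2 -> m <= (3 * P + K) / g.
Proof.
move=> P0 K0 g0 m1 h; have m0 : 0 < m by lra.
rewrite ler_pdivlMr// -(@ler_pM2r _ m)//.
have : 0 <= K * (m - 1) by rewrite mulr_ge0// subr_ge0.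
have : 0 <= P * (m - 1) by rewrite mulr_ge0 ?subr_ge0// ltW.
by move: h; lra.
Qed.

Section Criterion.
Variables (R : realType) (L rho beta : R) (A B : nat -> int).
Hypotheses (rho_gt0 : 0 < rho) (beta_ge0 : 0 <= beta).
Hypothesis form_asymp :
  (fun n => ln `|(B n)%:~R * L - (A n)%:~R| / n%:R ^+ 2) @ \oo --> - rho.
Hypothesis den_growth : forall e : R, 0 < e ->
  \forall n \near \oo, `|(B n)%:~R : R| <= expR ((beta + e) * n%:R ^+ 2).

Lemma linear_form_bounds (e : R) : 0 < e -> e < rho -> exists N : nat, forall n, (N <= n)%N ->
  expR (- (rho + e) * n%:R ^+ 2) <= `|(B n)%:~R * L - (A n)%:~R| <= expR (- (rho - e) * n%:R ^+ 2).
Proof.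
move=> e0 er; move/cvgrPdist_le : form_asymp => /(_ _ e0)[N _ hN].
exists N.+1 => n nN; have := hN n (ltnW nN); rewrite /= => h.
have n2 : 0 < n%:R ^+ 2 :> R by rewrite exprn_gt0// ltr0n; lia.
move: h; set d := `|_ * L - _|; rewrite ler_norml => /andP[h1 h2].
have d0 : 0 < d.
  (* As ln 0 = 0, a vanishing form would give the ratio 0, at distance rho > e from the limit. *)
  rewrite lt_neqAle normr_ge0 andbT eq_sym; apply/eqP => d0.
  by move: h1 h2; rewrite d0 ln0// mul0r; lra.
have e1 : d = expR (ln d / n%:R ^+ 2 * n%:R ^+ 2).
  by rewrite divfK ?gt_eqF// lnK.
by rewrite e1 !ler_expR !(ler_pM2r n2); apply/andP; split; lra.
Qed.

(** For an approximation s/t take the least n beyond a threshold with t |B_n L - A_n| guaranteed at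
    most 1/2. Comparing s B_n - t A_n with 0 gives r log t <= P n^2, while minimality bounds log t
    below by about (rho - e)(n - 1)^2; since r (rho - e) > P, n is bounded, and t with it. *)
Lemma approximation_denominators_bounded (r : R) : 1 + beta / rho < r ->
  exists W : R, forall st, approximations L r st -> st.2%:~R <= W.
Proof.
move=> hr.
have br : beta < (r - 1) * rho by rewrite -ltr_pdivrMr//; lra.
have r1 : 1 < r by apply: le_lt_trans hr; rewrite lerDl divr_ge0// ltW.
pose eta := (r - 1) * rho - beta; have eta0 : 0 < eta by rewrite /eta; lra.
have r2 : 0 < r + 2 by lra.
(* Chosen so that r (rho - e) - P = eta - (r + 2) e >= eta / 2, with P as below. *)
pose e := Num.min (eta / (2 * (r + 2))) (rho / 2).
have e0 : 0 < e by rewrite lt_min !divr_gt0//; lra.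
have e1 : (r + 2) * e <= eta / 2.
  have : e <= eta / (2 * (r + 2)) by rewrite ge_min lexx.
  rewrite ler_pdivlMr; last lra. lra.
have er : e <= rho / 2 by rewrite ge_min lexx orbT.
clearbody e.
have [N1 hN1] : exists N : nat, forall n, (N <= n)%N ->
    `|(B n)%:~R : R| <= expR ((beta + e) * n%:R ^+ 2).
  by have [N _ hN] := den_growth e0; exists N => n /hN.
have [|N2 hN2] := @linear_form_bounds e e0; first by lra.
pose N0 := (maxn N1 N2).
pose P := rho + beta + 2 * e; pose K := r * ln 2.
have ln2 : 0 <= ln 2 :> R by rewrite ln_ge0//; lra.
have K0 : 0 <= K by rewrite mulr_ge0//; lra.
have P0 : 0 < P by move: rho_gt0 beta_ge0 => ? ?; rewrite /P; lra.
pose M0 := (3 * P + K) / (eta / 2) + 1.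
have M1 : 1 <= M0 by rewrite lerDr divr_ge0//; lra.
pose W := (rho - e) * (M0 + 1) ^+ 2 + (rho - e) * N0.+1%:R ^+ 2.
exists (expR W) => -[s t] /= /andP[/= t0 hst].
have T0 : 0 < t%:~R :> R by rewrite ltr0z.
have T1 : 1 <= t%:~R :> R by rewrite ler1z -gtz0_ge1.
set T : R := t%:~R in T0 T1 hst *; pose w := ln T.
have Tw : T = expR w by rewrite lnK.
have w0 : 0 <= w by rewrite ln_ge0.
have hst' : `|T * L - s%:~R| < expR ((1 - r) * w).
  have -> : T * L - s%:~R = T * (L - s%:~R / T) by field; rewrite gt_eqF.
  rewrite normrM gtr0_norm// mulrBl mul1r expRB -Tw ltr_pM2l//.
  by move: hst; rewrite /powR gt_eqF// div1r.
have re0 : 0 < rho - e by lra.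
pose Q n := (N0.+1 <= n)%N && (ln 2 + w <= (rho - e) * n%:R ^+ 2).
have exQ : exists n, Q n.
  exists (maxn N0.+1 (Num.truncn ((ln 2 + w) / (rho - e))).+1); rewrite /Q leq_maxl/=.
  set m := maxn _ _; have mt : (ln 2 + w) / (rho - e) <= m%:R.
    by apply: (le_trans (ltW (truncnS_gt _))); rewrite ler_nat leq_maxr.
  have m1 : 1 <= m%:R :> R by rewrite ler1n leq_max ltn0Sn.
  rewrite -ler_pdivrMl// mulrC; apply: (le_trans mt).
  by rewrite expr2 ler_peMr//; lra.
case: (ex_minnP exQ) => n /andP[nN0 hn] nmin.
rewrite Tw ler_expR.
suff hnW : (n%:R - 1 <= M0) \/ n = N0.+1.
  have ln2w : w <= (rho - e) * n%:R ^+ 2 by lra.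
  apply: (le_trans ln2w); rewrite /W; case: hnW => [nM|->]; last first.
    by rewrite lerDr mulr_ge0 ?exprn_ge0//; lra.
  apply: (@le_trans _ _ ((rho - e) * (M0 + 1) ^+ 2)).
    by rewrite ler_pM2l// ler_pXn2r ?nnegrE//; lra.
  by rewrite lerDl mulr_ge0 ?exprn_ge0//; lra.
have [->|nN] := eqVneq n N0.+1; [by right|left].
have nlt : (N0.+1 < n)%N by rewrite ltn_neqAle eq_sym nN nN0.
have n1 : (1 < n)%N by apply: leq_ltn_trans nlt.
have npred : n.-1.+1 = n by rewrite prednK// ltnW.
pose m : R := n%:R - 1.
have m1 : 1 <= m.
  have : 2 <= n%:R :> R by rewrite ler_nat.
  by rewrite /m; lra.
have nm : n%:R = m + 1 :> R by rewrite /m subrK.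
have hpred : (rho - e) * m ^+ 2 < ln 2 + w.
  rewrite ltNge; apply/negP => h; have := nmin n.-1; rewrite /Q.
  have -> : n.-1%:R = m :> R by rewrite /m -subn1 natrB// ltnW.
  by rewrite h andbT -ltnS npred nlt => /(_ isT); rewrite leqNgt -ltnS npred ltnS leqnn.
have nN1 : (N1 <= n)%N by rewrite (leq_trans (leq_maxl N1 N2))// ltnW.
have nN2 : (N2 <= n)%N by rewrite (leq_trans (leq_maxr N1 N2))// ltnW.
have hB := hN1 n nN1; have /andP[hd1 hd2] := hN2 n nN2.
set d := _ * L - _ in hd1 hd2.
have half : expR (- ln 2) = 2^-1 :> R by rewrite expRN lnK// posrE.
have hTd : T * `|d| <= 2^-1.
  rewrite -half; apply: (@le_trans _ _ (expR (w - (rho - e) * n%:R ^+ 2))).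
    by rewrite expRD -Tw ler_pM2l// -mulNr.
  by rewrite ler_expR; lra.
have hBs : `|(B n)%:~R * (T * L - s%:~R)| <= expR ((beta + e) * n%:R ^+ 2 + (1 - r) * w).
  by rewrite normrM expRD ler_pM// ltW.
(* If s B_n = t A_n, then t d = B_n (t L - s) and the lower bound on |d| applies. Otherwise the
   integer s B_n - t A_n has absolute value at least 1, and t |d| <= 1/2 leaves |B_n (t L - s)| >=
   1/2. *)
have key : r * w <= P * n%:R ^+ 2.
  have sBtA : (s * B n - t * A n)%:~R = T * d - (B n)%:~R * (T * L - s%:~R).
    by rewrite rmorphB !rmorphM/= -/T /d; ring.
  have n2 : 0 <= n%:R ^+ 2 :> R by rewrite exprn_ge0.
  have [e2|ne] := eqVneq (s * B n - t * A n) 0.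
    move: sBtA; rewrite e2 => /esym/eqP; rewrite subr_eq0 => /eqP Td.
    move: hBs; rewrite -Td normrM (gtr0_norm T0) => h.
    have : expR (w - (rho + e) * n%:R ^+ 2) <= expR ((beta + e) * n%:R ^+ 2 + (1 - r) * w).
      by apply: le_trans h; rewrite expRD -Tw ler_pM2l// -mulNr.
    by rewrite ler_expR /P; lra.
  have : 1 <= `|(s * B n - t * A n)%:~R : R| by rewrite -intr_norm ler1z -gtz0_ge1 normr_gt0.
  rewrite sBtA => h; have := ler_normB (T * d) ((B n)%:~R * (T * L - s%:~R)).
  rewrite [`|T * d|]normrM (gtr0_norm T0) => h'.
  have : expR (- ln 2) <= expR ((beta + e) * n%:R ^+ 2 + (1 - r) * w) by rewrite half; lra.
  by rewrite ler_expR /P; nra.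
have m2 : 0 <= m ^+ 2 by rewrite exprn_ge0//; lra.
have h1 : r * ((rho - e) * m ^+ 2) <= r * (ln 2 + w) by rewrite ler_pM2l ?(ltW hpred)//; lra.
have h2 : (P + eta / 2) * m ^+ 2 <= r * (rho - e) * m ^+ 2.
  by apply: ler_wpM2r => //; rewrite /P /eta in e1 *; lra.
rewrite -/m; apply: (@le_trans _ _ ((3 * P + K) / (eta / 2))); last by rewrite /M0 lerDl.
apply: quadratic_gap_bound => //; first by rewrite divr_gt0.
apply: (le_trans h2); rewrite -mulrA; apply: (le_trans h1).
by rewrite mulrDr lerD2l -nm.
Qed.

Lemma irrationality_measure_le : (irrationality_measure L <= (1 + beta / rho)%:E)%E.
Proof.
apply/lee_addgt0Pr => e e0; rewrite -EFinD; apply: ereal_inf_lbound.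
exists (1 + beta / rho + e) => //=; set r := _ + e.
have hr : 1 + beta / rho < r by rewrite ltrDl.
have r1 : 1 < r by apply: le_lt_trans hr; rewrite lerDl divr_ge0// ltW.
have [W hW] := approximation_denominators_bounded hr.
clearbody r.
pose M := (Num.truncn (W * (`|L| + 1))).+1.
(* Bounded t bounds s as well, since |s/t| <= |L| + 1; the shift by M indexes the signed s by
   naturals. *)
apply: (@sub_finite_set _ _ ((fun ij : nat * nat => (ij.1%:Z - M%:Z, ij.2%:Z)) @` (`I_(M + M) `*` `I_M))).
  move=> [s t] /= h; have /= tW := hW _ h; move: h => /andP[/= t0 h].
  have T0 : 0 < t%:~R :> R by rewrite ltr0z.
  have T1 : 1 <= t%:~R :> R by rewrite ler1z -gtz0_ge1.
  have WM : W * (`|L| + 1) < M%:R by exact: truncnS_gt.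
  have L0 := normr_ge0 L.
  have tM : t%:~R < M%:R :> R by nra.
  have sM : `|s%:~R| < M%:R :> R.
    have h1 : 1 / t%:~R `^ r <= 1 :> R.
      have p1 : 1 <= t%:~R `^ r :> R.
        by have := ler_powR T1 (ltW (lt_trans ltr01 r1)); rewrite powRr0.
      by rewrite div1r invf_le1// (lt_le_trans ltr01 p1).
    have h2 : `|s%:~R / t%:~R : R| <= `|L| + 1.
      have := ler_normB L (L - s%:~R / t%:~R); rewrite opprB addrC subrK; lra.
    rewrite normf_div [X in _ / X]gtr0_norm// ler_pdivrMr// in h2.
    by nra.
  move: sM; rewrite -intr_norm => sM.
  have {}tM : (t < M%:Z) by rewrite -(ltr_int R).
  have {}sM : (`|s| < M%:Z) by rewrite -(ltr_int R).
  clear -t0 sM tM.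
  exists (absz (s + M%:Z)%R, absz t) => /=; first by split; lia.
  by congr (_, _); lia.
by apply: finite_image; apply: finite_setX; exact: finite_II.
Qed.

(** A rational L has error 0 at k num / (k den) for every k > 0, so its approximations would have
    unbounded denominators. *)
Lemma irrational_of_forms : irrational L.
Proof.
move=> [x _ xL].
have hr : 1 + beta / rho < 1 + beta / rho + 1 by rewrite ltrDl.
have [W hW] := approximation_denominators_bounded hr.
pose k := (Num.truncn W).+1.
have Wk : W < k%:R by exact: truncnS_gt.
have d0 : 0 < (denq x)%:~R :> R by rewrite ltr0z denq_gt0.
have /= := hW (numq x * k%:Z, denq x * k%:Z); rewrite rmorphM/= => /(_ _).
have k0 : 0 < k%:R :> R by rewrite ltr0n.
have tk : (denq x * k%:Z)%:~R = (denq x)%:~R * k%:R :> R by rewrite rmorphM.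
rewrite leNgt => /(_ _)/negP; apply.
  apply/andP; split; first by rewrite /= mulr_gt0.
  rewrite /= tk rmorphM/= -xL /ratr -mulf_div divff ?gt_eqF// mulr1 subrr normr0.
  by rewrite divr_gt0// powR_gt0// mulr_gt0.
apply: (lt_le_trans Wk); rewrite ler_peMl ?(ltW k0)//.
by rewrite ler1z -gtz0_ge1.
Qed.

End Criterion.

(** * Limits of sequences divided by n^2 *)

Section LogAsymptotics.
Variable R : realType.

Lemma cvg_eventually_eq (u v : nat -> R) (l : R) (N : nat) :
  (forall n, (N <= n)%N -> u n = v n) -> v @ \oo --> l -> u @ \oo --> l.
Proof.
move=> uv /cvgrPdist_le vl; apply/cvgrPdist_le => e e0.
have [M _ hM] := vl _ e0; exists (maxn N M) => // n /=; rewrite geq_max => /andP[Nn Mn].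
by rewrite uv//; apply: hM.
Qed.

Lemma cvg_linear_error (D : nat -> R) (l C : R) (N : nat) :
  (forall n, (N <= n)%N -> `|D n - l * n%:R ^+ 2| <= C * n%:R) ->
  (fun n => D n / n%:R ^+ 2) @ \oo --> l.
Proof.
move=> h; have ic := @cvg_invn_nat R.
apply: (@squeeze_cvgr _ _ _ _ (fun n => l - C * n%:R^-1) (fun n => l + C * n%:R^-1)).
- exists N.+1 => // n /= nN; have n0 : 0 < n%:R :> R by rewrite ltr0n; lia.
  have := h n (ltnW nN); rewrite ler_norml => /andP[h1 h2].
  rewrite ler_pdivlMr ?exprn_gt0// ler_pdivrMr ?exprn_gt0//.
  rewrite (_ : (l - _) * _ = l * n%:R ^+ 2 - C * n%:R); last by field; rewrite gt_eqF.
  rewrite (_ : (l + _) * _ = l * n%:R ^+ 2 + C * n%:R); last by field; rewrite gt_eqF.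
  by apply/andP; split; lra.
- rewrite -[X in _ --> X]subr0; apply: cvgB; first exact: cvg_cst.
  by rewrite -[X in _ --> X](mulr0 C); apply: cvgM => //; exact: cvg_cst.
- rewrite -[X in _ --> X]addr0; apply: cvgD; first exact: cvg_cst.
  by rewrite -[X in _ --> X](mulr0 C); apply: cvgM => //; exact: cvg_cst.
Qed.

Lemma natr_bin2S n : 'C(n.+1, 2)%:R = n%:R * (n%:R + 1) / 2 :> R.
Proof.
elim: n => [|n IHn]; first by rewrite mul0r mul0r.
by rewrite binS bin1 natrD IHn -natr1; field.
Qed.

End LogAsymptotics.

(** * Growth of (c;p)_n, R_n and P_n(c p^n) *)

Section Asymptotics.
Variables (R : realType) (p : nat) (c : R).
Hypotheses (p_gt1 : (1 < p)%N) (c_neq0 : c != 0).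
Let t : R := p%:R.
Let q : R := t^-1.
Let lp : R := ln t.
Hypothesis c_neq : forall k : nat, c * t ^+ k != 1.

Let t_gt1 : 1 < t. Proof. by rewrite /t ltr1n. Qed.
Let t_gt0 : 0 < t. Proof. exact: lt_trans ltr01 t_gt1. Qed.
Let t_neq0 : t != 0. Proof. by rewrite gt_eqF. Qed.
Let q_gt0 : 0 < q. Proof. by rewrite invr_gt0. Qed.
Let q_lt1 : q < 1. Proof. by rewrite invf_lt1. Qed.
Let lp_gt0 : 0 < lp. Proof. by rewrite ln_gt0. Qed.
Let tX n : t ^+ n = expR (n%:R * lp).
Proof. by rewrite mulr_natl -lnXn// lnK// posrE exprn_gt0. Qed.

Lemma qpoch_base_neq0 n : qpoch c t n != 0.
Proof. by apply: qpoch_neq0 => i _. Qed.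

(** 1 - c t^i = t^i (q^i - c), and log |q^i - c| is bounded because q^i - c never vanishes and tends
    to -c. The powers t^i contribute lp n (n - 1) / 2. *)
Lemma ln_qpoch_asymp : exists C, forall n : nat,
  `|ln `|qpoch c t n| - lp / 2 * n%:R ^+ 2| <= C * n%:R.
Proof.
have qc0 i : q ^+ i - c != 0.
  apply/negP; rewrite subr_eq0 => /eqP e; have := c_neq i.
  by rewrite -e exprVn mulVf ?eqxx// expf_neq0.
have qc : (fun j => q ^+ j) @ \oo --> (0 : R).
  by apply: cvg_expr; rewrite ger0_norm// ltW.
have gc : (fun j => (q ^+ j - c)^-1) @ \oo --> (0 - c)^-1.
  by apply: cvgV; [rewrite sub0r oppr_eq0|apply: cvgB => //; exact: cvg_cst].
have [M0 [_ hM0]] := cvg_seq_bounded (cvgP _ gc).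
pose M := `|M0| + 1.
have hM i : `|(q ^+ i - c)^-1| <= M.
  by apply: (hM0 M _ i I); rewrite /M; have := ler_norm M0; lra.
have M1 : 1 <= M by rewrite lerDr.
have c1 : 1 <= 1 + `|c| by rewrite lerDl.
pose C0 := ln M + ln (1 + `|c|).
have lM : 0 <= ln M by rewrite ln_ge0.
have lc : 0 <= ln (1 + `|c|) by rewrite ln_ge0.
have yb i : `|ln `|q ^+ i - c| | <= C0.
  have d0 : 0 < `|q ^+ i - c| by rewrite normr_gt0.
  have u1 : `|q ^+ i - c| <= 1 + `|c|.
    apply: (le_trans (ler_normB _ _)); rewrite lerD2r ger0_norm ?exprn_ge0 ?(ltW q_gt0)//.
    by rewrite exprn_ile1// ltW.
  have u2 : M^-1 <= `|q ^+ i - c|.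
    rewrite -[leRHS]invrK lef_pV2 ?posrE ?invr_gt0//; last by lra.
    by rewrite -normfV.
  have l1 : ln `|q ^+ i - c| <= ln (1 + `|c|) by rewrite ler_ln ?posrE//; lra.
  have l2 : - ln M <= ln `|q ^+ i - c|.
    by rewrite -lnV ?posrE ?ler_ln ?posrE ?invr_gt0//; lra.
  by rewrite ler_norml /C0; apply/andP; split; lra.
exists (C0 + lp / 2) => n.
suff h : `|ln `|qpoch c t n| - (lp / 2 * n%:R ^+ 2 - lp / 2 * n%:R)| <= C0 * n%:R.
  have n0 : 0 <= n%:R :> R by [].
  have ln0 : 0 <= lp / 2 * n%:R by rewrite mulr_ge0// divr_ge0// ltW.
  by move: h; rewrite !ler_norml => /andP[h1 h2]; apply/andP; split; lra.
elim: n => [|n IHn].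
  by rewrite qpoch0 normr1 ln1 expr0n/= !mulr0 !subr0 normr0.
rewrite qpochS normrM lnM ?posrE ?normr_gt0 ?qpoch_base_neq0//; last first.
  by rewrite subr_eq0 eq_sym.
have -> : ln `|1 - c * t ^+ n| = n%:R * lp + ln `|q ^+ n - c|.
  rewrite -[1 - _](_ : t ^+ n * (q ^+ n - c) = _); last first.
    by rewrite mulrBr exprVn divff ?expf_neq0// [c * _]mulrC.
  rewrite normrM gtr0_norm ?exprn_gt0// lnM ?posrE ?exprn_gt0 ?normr_gt0//.
  by rewrite lnXn// mulr_natl.
have y := yb n; have -> : n.+1%:R = n%:R + 1 :> R by rewrite natr1.
move: IHn y; rewrite !ler_norml => /andP[h1 h2] /andP[h3 h4].
by apply/andP; split; lra.
Qed.

(** Of the coefficient 3/2, 1/2 comes from q^(n(n+1)/2) and 1 from |x|^(n+1) with x = c t^n. The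
    threshold on n ensures |x| >= 64, by t^n > n. *)
Lemma ln_remainder_asymp (r : nat -> R) :
  (forall n : nat, (0 < n)%N -> has_sum (fun j => littleqLegendre q n (q ^+ j) *
     (q ^+ j / (c * t ^+ n - q ^+ j))) (r n)) ->
  exists C (N : nat), forall n : nat, (N <= n)%N ->
    r n != 0 /\ `|ln `|r n| - (- (3 / 2 * lp)) * n%:R ^+ 2| <= C * n%:R.
Proof.
move=> hr; have c0 : 0 < `|c| by rewrite normr_gt0.
exists (ln 8 + 2 * `|ln `|c| | + 3 * lp), (Num.truncn (64 / `|c|)).+1 => n nN.
have n1 : (0 < n)%N by apply: leq_trans nN.
have n1R : 1 <= n%:R :> R by rewrite ler1n.
have x64 : 64 <= `|c * t ^+ n|.
  rewrite normrM [`|t ^+ n|]gtr0_norm ?exprn_gt0// -ler_pdivrMl// mulrC.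
  apply: (le_trans (ltW (truncnS_gt _))); apply: (@le_trans _ _ n%:R); first by rewrite ler_nat.
  by rewrite /t -natrX ler_nat ltnW// ltn_expl.
have /andP[b1 b2] := legendre_remainder_bound p_gt1 x64 (hr n n1).
set Y := p%:R^-1 ^+ _ in b1 b2.
have Y0 : 0 < Y by rewrite exprn_gt0.
have xp : 0 < `|c * t ^+ n| ^+ n.+1 by rewrite exprn_gt0// (lt_le_trans _ x64).
have r0 : 0 < `|r n|.
  rewrite -(pmulr_rgt0 _ xp); apply: lt_le_trans b1; by rewrite mulr_gt0.
split; first by rewrite -normr_gt0.
have lY : ln Y = - (n%:R * (n%:R + 1) / 2 * lp).
  rewrite /Y exprVn lnV ?posrE ?exprn_gt0// lnXn// -[ln _ *+ _]mulr_natl natr_bin2S//.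
have lx : ln (`|c * t ^+ n| ^+ n.+1) = (n%:R + 1) * (ln `|c| + n%:R * lp).
  rewrite lnXn ?(lt_le_trans _ x64)// -[ln _ *+ _]mulr_natl natr1 normrM lnM ?posrE ?normr_gt0 ?expf_neq0//.
  by rewrite [`|t ^+ n|]gtr0_norm ?exprn_gt0// lnXn// -[ln _ *+ _]mulr_natl.
have e1 : - ln 8 + ln Y <= ln (`|c * t ^+ n| ^+ n.+1) + ln `|r n|.
  rewrite -lnV ?posrE// -!lnM ?posrE ?invr_gt0// ler_ln ?posrE//; exact: mulr_gt0.
have e2 : ln (`|c * t ^+ n| ^+ n.+1) + ln `|r n| <= ln 5 + ln Y.
  rewrite -!lnM ?posrE// ler_ln ?posrE//; exact: mulr_gt0.
have l58 : ln 5 <= ln 8 :> R by rewrite ler_ln ?posrE//; lra.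
have l8 : 0 <= ln 8 :> R by rewrite ln_ge0//; lra.
rewrite lY lx in e1 e2.
have a1 := ler_norm (ln `|c|); have a2 := ler_norm (- ln `|c|); rewrite normrN in a2.
have a0 := normr_ge0 (ln `|c|).
move: e1 e2 a1 a2 a0 l8 l58 n1R lp_gt0 => {lY lx b1 b2 x64 xp r0 Y0}.
move: (ln 8) (ln 5) (ln `|r n|) (ln `|c|) (`|ln `|c| |) (n%:R) lp => l8 l5 X k K x l *.
have ? : 0 <= (x - 1) * K by rewrite mulr_ge0// subr_ge0.
have ? : 0 <= (x - 1) * l8 by rewrite mulr_ge0// subr_ge0.
have ? : 0 <= x * l by rewrite mulr_ge0//; lra.
have ? : 0 <= x * (K - k) by rewrite mulr_ge0//; lra.
have ? : 0 <= x * (K + k) by rewrite mulr_ge0//; lra.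
by rewrite ler_norml; apply/andP; split; lra.
Qed.

(** Termwise estimate in the basis (q x; q)_k. The factor 2^(3n) bounds the two Gaussian binomials,
    and a further 2^n the number n + 1 of terms. *)
Lemma legendre_growth : exists C, forall n : nat,
  `|littleqLegendre q n (c * t ^+ n)| <= expR (3 / 2 * lp * n%:R ^+ 2 + C * n%:R).
Proof.
pose c1 := 1 + `|c|; have c11 : 1 <= c1 by rewrite lerDl.
have qp n k : (k <= n)%N ->
    `|qpoch (q * (c * t ^+ n)) q k| * t ^+ 'C(k.+1, 2) <= c1 ^+ k * t ^+ (n * k).
  elim: k => [|k IHk] kn; first by rewrite qpoch0 normr1 !expr0 muln0 mul1r.
  rewrite qpochS normrM binS bin1 exprD mulrACA [c1 ^+ k.+1]exprSr mulnSr [t ^+ (n * k + n)]exprD [leRHS]mulrACA.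
  rewrite ler_pM ?mulr_ge0 ?exprn_ge0 ?(ltW t_gt0)//; first by apply: IHk; lia.
  have -> : q * (c * t ^+ n) * q ^+ k = c * (t ^+ n / t ^+ k.+1).
    by rewrite /q exprVn exprS; field; rewrite t_neq0 expf_neq0.
  rewrite -expfB_cond ?(negbTE t_neq0)// -[n in leRHS](subnK kn) exprD mulrA.
  rewrite ler_wpM2r ?exprn_ge0 ?(ltW t_gt0)//.
  apply: (le_trans (ler_normB _ _)); rewrite normr1 normrM.
  have T1 : 1 <= t ^+ (n - k.+1) by rewrite exprn_ege1// ltW.
  rewrite [`|t ^+ _|]ger0_norm; last by lra.
  by rewrite /c1; have := normr_ge0 c; nra.
exists (4 * ln 2 + ln c1 + lp / 2) => n.
rewrite littleqLegendreE//; apply: (le_trans (ler_norm_sum _ _ _)).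
pose E := 2 ^+ (3 * n) * c1 ^+ n * expR (3 / 2 * lp * n%:R ^+ 2 + lp / 2 * n%:R).
apply: (@le_trans _ _ (\sum_(k < n.+1) E)).
  apply: ler_sum => k _; have kn : (k <= n)%N by rewrite -ltnS.
  have tC : 0 < t ^+ 'C(k.+1, 2) by rewrite exprn_gt0.
  rewrite -(ler_pM2r tC) normrM -mulrA.
  have ek : `|legendre_coef R p n k| <=
      2 ^+ (3 * n) * t ^+ (k * (n - k) + k * n + 'C((n - k).+1, 2)).
    rewrite /legendre_coef normrM normrX normrN1 expr1n mul1r ger0_norm// /t -!natrX -natrM ler_nat.
    rewrite (leq_trans (leq_mul (leq_mul (qbin_le _ _ (ltnW p_gt1)) (qbin_le _ _ (ltnW p_gt1))) (leqnn _)))//.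
    rewrite addnK mulnACA -mulnA -!expnD leq_mul2r leq_exp2l//.
    by apply/orP; right; lia.
  have h1 := qp n k kn; set A := `|legendre_coef _ _ _ _| in ek *.
  set B := `|qpoch _ _ _| * _ in h1 *.
  apply: (@le_trans _ _ ((2 ^+ (3 * n) * t ^+ (k * (n - k) + k * n + 'C((n - k).+1, 2))) *
     (c1 ^+ k * t ^+ (n * k)))).
    by rewrite ler_pM// /A /B ?normr_ge0// mulr_ge0// ltW.
  rewrite mulrACA -exprD /E -!mulrA ler_pM2l ?exprn_gt0// ler_pM//.
  - by rewrite exprn_ge0//; lra.
  - by rewrite exprn_ge0// ltW.
  - by rewrite ler_weXn2l.
  rewrite !tX -expRD ler_expR.
  (* After subtracting k (k + 1) / 2 the exponent is 3 n^2 / 2 + n / 2 - (n - k)^2 - k, so the terms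
     with k near n dominate. *)
  have -> : (k * (n - k) + k * n + 'C((n - k).+1, 2) + n * k)%:R =
     k%:R * (n%:R - k%:R) + 2 * k%:R * n%:R + (n%:R - k%:R) * (n%:R - k%:R + 1) / 2 :> R.
    by rewrite (natrD _ _ (n * k)) (natrD _ _ 'C(_, 2)) (natrD _ (k * (n - k))) natr_bin2S !natrM natrB//; ring.
  rewrite natr_bin2S; move: (n%:R : R) (k%:R : R) (ler0n R k) lp_gt0 => x y y0 l0.
  have ? : 0 <= (x - y) ^+ 2 * lp by rewrite mulr_ge0 ?sqr_ge0// ltW.
  have ? : 0 <= y * lp by rewrite mulr_ge0// ltW.
  by lra.
rewrite sumr_const card_ord -[E *+ _]mulr_natr.
apply: (@le_trans _ _ (E * 2 ^+ n)).
  rewrite ler_wpM2l ?mulr_ge0 ?exprn_ge0 ?expR_ge0//; first by lra.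
  by rewrite -natrX ler_nat ltn_expl.
have eX (x : R) m : 0 < x -> x ^+ m = expR (m%:R * ln x).
  by move=> x0; rewrite mulr_natl -lnXn// lnK// posrE exprn_gt0.
have c10 : 0 < c1 by lra.
rewrite /E ![2 ^+ _]eX// [c1 ^+ n]eX// -!expRD ler_expR natrM; lra.
Qed.

End Asymptotics.

(** * The forms b_n L - a_n for c different from 1 *)

Section LinearForms.
Variables (R : realType) (p : nat) (a b : int).
Hypotheses (p_gt1 : (1 < p)%N) (b_neq0 : b != 0).
Let t : R := p%:R.
Let q : R := t^-1.
Let lp : R := ln t.
Let c : R := a%:~R / b%:~R.
Hypotheses (c_neq0 : c != 0) (c_neq : forall k : nat, c * t ^+ k != 1).

Let t_gt1 : 1 < t. Proof. by rewrite /t ltr1n. Qed.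
Let t_gt0 : 0 < t. Proof. exact: lt_trans ltr01 t_gt1. Qed.
Let lp_gt0 : 0 < lp. Proof. by rewrite ln_gt0. Qed.
Let c_neqS k : (1 <= k)%N -> c * t ^+ k != 1. Proof. by []. Qed.

(** The partial sum in a_n cancels the head of L, which leaves P_n(x) T - Q_n(x); in the combined
    series the terms P_n(x) q^j / (x - q^j) cancel. *)
Lemma approx_form_remainder n : (0 < n)%N -> exists r,
  has_sum (fun j => littleqLegendre q n (q ^+ j) * (q ^+ j / (c * t ^+ n - q ^+ j))) r /\
  approx_den R p a b n * lambert_sum c p - approx_num R p a b n =
  b%:~R ^+ (2 * n) * (cyclotomic_prod n p)%:~R * qpoch c t n * r.
Proof.
move=> n0; have x0 : c * t ^+ n != 0 by rewrite mulf_neq0// expf_neq0// gt_eqF.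
have [T hT] := lambert_tail_sum p_gt1 x0.
have xq j : c * t ^+ n != q ^+ j by exact: shifted_neq_qpow.
have hQ := @littleqLegendre_assoc_sum R p p_gt1 n _ xq.
pose Q := littleqLegendre_assoc q n (c * t ^+ n).
exists (littleqLegendre q n (c * t ^+ n) * T + -1 * Q); split.
  have := has_sumD (has_sumZ (a := littleqLegendre q n (c * t ^+ n)) hT)
    (has_sumZ (a := -1) hQ).
  rewrite /Q littleqLegendre_assocE//; congr has_sum; apply/funext => j.
  by rewrite mulN1r -/t -/q; ring.
have -> : lambert_sum c p = \sum_(1 <= k < n) lambert_term c p k + T.
  by apply: cvg_lim => //; exact: lambert_sum_cvg.
rewrite /approx_num /approx_den -/c -/t -/q -/Q; ring.
Qed.

Let Z := pi ^+ 2 / 6 : R.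
(** In units of lp the prefactor exp(F n) has exponent 1/2 + 3/pi^2. Subtracting the 3/2 of R_n
    gives -rho, adding the 3/2 of P_n gives beta. *)
Let rho := lp * ((pi ^+ 2 - 3) / pi ^+ 2).
Let beta := lp * (2 + 3 / pi ^+ 2).
Let F n : R := 2 * n%:R * ln `|b%:~R| + ln `|(cyclotomic_prod n p)%:~R| + ln `|qpoch c t n|.

Let F_cvg : (fun n => F n / n%:R ^+ 2) @ \oo --> lp / 2 + lp / (2 * Z).
Proof.
have pi2 : 0 < pi ^+ 2 :> R by rewrite exprn_gt0// pi_gt0.
have Z0 : 0 < Z by rewrite divr_gt0.
have h1 := ln_cyclotomic_prod_cvg p_gt1 Z0 (@basel R).
have [C hC] := ln_qpoch_asymp p_gt1 c_neq0 c_neq.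
have h2 := @cvg_linear_error R (fun n => ln `|qpoch c t n|) (lp / 2) C 0 (fun n _ => hC n).
have h3 : (fun n => 2 * n%:R * ln `|b%:~R| / n%:R ^+ 2) @ \oo --> (0 : R).
  apply: (@cvg_linear_error R _ _ (2 * `|ln `|b%:~R : R| |) 0) => n _.
  by rewrite mul0r subr0 normrM [`|2 * n%:R|]ger0_norm ?mulr_ge0// mulrAC.
rewrite (_ : (fun _ => _) = (fun n => 2 * n%:R * ln `|b%:~R| / n%:R ^+ 2 +
   ln `|qpoch c t n| / n%:R ^+ 2 + ln `|(cyclotomic_prod n p)%:~R : R| / n%:R ^+ 2)).
  rewrite -[X in _ --> X + _](add0r (lp / 2)); apply: cvgD => //; exact: cvgD.
by apply/funext => n; rewrite /F -!mulrDl addrAC.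
Qed.

Lemma cyclotomic_prod_neq0 n : (cyclotomic_prod n p)%:~R != 0 :> R.
Proof.
rewrite intr_eq0 /cyclotomic_prod prodf_seq_neq0; apply/allP => k.
by rewrite mem_index_iota => /andP[k0 _]; rewrite cyclotomic_at_neq0.
Qed.

Let bR0 : b%:~R != 0 :> R. Proof. by rewrite intr_eq0. Qed.

Let absX n : `|b%:~R ^+ (2 * n) * (cyclotomic_prod n p)%:~R * qpoch c t n| = expR (F n).
Proof.
rewrite !normrM /F !expRD !lnK ?posrE ?normr_gt0 ?cyclotomic_prod_neq0 ?qpoch_base_neq0//.
congr (_ * _ * _); rewrite normrX -natrM mulr_natl -lnXn ?normr_gt0// lnK//.
by rewrite posrE exprn_gt0// normr_gt0.
Qed.

Lemma approx_form_asymp :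
  (fun n => ln `|approx_den R p a b n * lambert_sum c p - approx_num R p a b n| / n%:R ^+ 2)
    @ \oo --> - rho.
Proof.
have /choice[r hr] : forall n : nat, exists r, (0 < n)%N ->
  has_sum (fun j => littleqLegendre q n (q ^+ j) * (q ^+ j / (c * t ^+ n - q ^+ j))) r /\
  approx_den R p a b n * lambert_sum c p - approx_num R p a b n =
  b%:~R ^+ (2 * n) * (cyclotomic_prod n p)%:~R * qpoch c t n * r.
  case=> [|n]; first by exists 0.
  by have [r hr] := @approx_form_remainder n.+1 isT; exists r.
have [C [N hN]] := ln_remainder_asymp p_gt1 c_neq0 (fun n n0 => (hr n n0).1).
have h2 := @cvg_linear_error R (fun n => ln `|r n|) _ C N (fun n nN => (hN n nN).2).
apply: (@cvg_eventually_eq R _ (fun n => F n / n%:R ^+ 2 + ln `|r n| / n%:R ^+ 2) _ N.+1).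
  move=> n nN; have n0 : (0 < n)%N by apply: leq_trans nN.
  rewrite (hr n n0).2 normrM absX lnM ?posrE ?expR_gt0 ?normr_gt0//; last exact: (hN n (ltnW nN)).1.
  by rewrite expRK mulrDl.
rewrite (_ : - rho = lp / 2 + lp / (2 * Z) + - (3 / 2 * lp)); first exact: cvgD.
have := @pi_gt0 R; rewrite /rho /Z -/t -/lp; move: (pi : R) => P P0.
by field; rewrite gt_eqF.
Qed.

Lemma approx_den_growth (e : R) : 0 < e ->
  \forall n \near \oo, `|approx_den R p a b n| <= expR ((beta + e) * n%:R ^+ 2).
Proof.
move=> e0; have [C hC] := legendre_growth p_gt1 c_neq0.
have h : (fun n => (F n + (3 / 2 * lp * n%:R ^+ 2 + C * n%:R)) / n%:R ^+ 2) @ \oo --> beta.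
  have h1 := @cvg_linear_error R (fun n => 3 / 2 * lp * n%:R ^+ 2 + C * n%:R) (3 / 2 * lp) `|C| 0.
  rewrite (_ : (fun _ => _) = (fun n => F n / n%:R ^+ 2 +
     (3 / 2 * lp * n%:R ^+ 2 + C * n%:R) / n%:R ^+ 2)); last by apply/funext => n; rewrite mulrDl.
  rewrite (_ : beta = lp / 2 + lp / (2 * Z) + 3 / 2 * lp); last first.
    have := @pi_gt0 R; rewrite /beta /Z; move: (pi : R) => P P0.
    by field; rewrite gt_eqF.
  apply: cvgD => //; apply: h1 => n _.
  by rewrite addrAC subrr add0r normrM [`|n%:R|]ger0_norm.
move/cvgrPdist_le : h => /(_ _ e0)[N _ hN]; exists N.+1 => // n /= nN.
have n2 : 0 < n%:R ^+ 2 :> R by rewrite exprn_gt0// ltr0n; lia.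
have := hN n (ltnW nN); rewrite /= ler_norml => /andP[h1 _].
have {}h1 : (F n + (3 / 2 * lp * n%:R ^+ 2 + C * n%:R)) / n%:R ^+ 2 <= beta + e by lra.
rewrite ler_pdivrMr// in h1.
rewrite /approx_den -/c -/t -/q normrM absX; apply: (@le_trans _ _ (expR (F n) *
  expR (3 / 2 * lp * n%:R ^+ 2 + C * n%:R))).
  by apply: ler_wpM2l (hC n); exact: expR_ge0.
by rewrite -expRD ler_expR.
Qed.

Lemma lambert_linear_forms : exists A B : nat -> int,
  (fun n => ln `|(B n)%:~R * lambert_sum c p - (A n)%:~R| / n%:R ^+ 2) @ \oo --> - rho /\
  forall e : R, 0 < e ->
    \forall n \near \oo, `|(B n)%:~R : R| <= expR ((beta + e) * n%:R ^+ 2).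
Proof.
have int n : exists AB : int * int,
    approx_num R p a b n = AB.1%:~R /\ approx_den R p a b n = AB.2%:~R.
  have [/intrP[A hA] /intrP[B hB]] := approx_int p_gt1 b_neq0 c_neqS n.
  by exists (A, B).
have /choice[AB hAB] := int.
exists (fun n => (AB n).1), (fun n => (AB n).2); split.
  apply: (cvg_eventually_eq (N := 0)) approx_form_asymp => n _.
  by have [-> ->] := hAB n.
by move=> e /approx_den_growth[N _ hN]; exists N => // n /hN /=; rewrite (hAB n).2.
Qed.

End LinearForms.

(** * The case c = 1 and the conclusion *)

Lemma lambert_sum1E (R : realType) (p : nat) : (1 < p)%N ->
  lambert_sum (1 : R) p = (p%:R - 1)^-1 + lambert_sum (p%:R : R) p.
Proof.
move=> p_gt1; set t : R := p%:R.
have t_gt1 : 1 < t by rewrite ltr1n.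
have t0 : t != 0 by rewrite gt_eqF// (lt_trans ltr01).
have x0 : t * t ^+ 1 != 0 by rewrite mulf_neq0.
have [T hT] := lambert_tail_sum p_gt1 x0.
have cv := lambert_sum_cvg p_gt1 (ltn0Sn 0) hT.
rewrite [in RHS]/lambert_sum (cvg_lim _ cv)//; apply: cvg_lim => //.
rewrite -(cvg_shiftn 1).
apply: (@cvg_eventually_eq R _ (fun N => (t - 1)^-1 + \sum_(1 <= k < N) lambert_term t p k) _ 1).
  move=> N N1 /=; rewrite addn1 big_ltn// {1}/lambert_term !mul1r expr1; congr (_ + _).
  by rewrite big_add1/=; apply: eq_bigr => k _; rewrite /lambert_term !mul1r exprS.
by apply: cvgD => //; exact: cvg_cst.
Qed.

(** Since ln 0 = 0, the condition l <> 0 forces u n <> 0 eventually, and there the power is exp(ln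
    (u n) / n^2). *)
Lemma powR_inv_sqr_cvg (R : realType) (u : nat -> R) (l : R) : (forall n, 0 <= u n) -> l != 0 ->
  (fun n => ln (u n) / n%:R ^+ 2) @ \oo --> l ->
  (fun n => u n `^ (1 / n%:R ^+ 2)) @ \oo --> expR l.
Proof.
move=> u0 l0 h; have l2 : 0 < `|l| / 2 by rewrite divr_gt0// normr_gt0.
have /cvgrPdist_le/(_ _ l2)[N _ hN] := h.
apply: (@cvg_eventually_eq R _ (fun n => expR (ln (u n) / n%:R ^+ 2)) _ N).
  move=> n /hN /= hn; rewrite /powR; case: eqP => [e|_]; last by rewrite div1r mulrC.
  have : 0 < `|l| by rewrite normr_gt0.
  by move: hn; rewrite e ln0// mul0r subr0; lra.
exact: (continuous_cvg _ (@continuous_expR R l) h).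
Qed.

Lemma ln_scale_cvg (R : realType) (u : nat -> R) (m l : R) : 0 < m -> l != 0 ->
  (fun n => ln `|u n| / n%:R ^+ 2) @ \oo --> l ->
  (fun n => ln `|m * u n| / n%:R ^+ 2) @ \oo --> l.
Proof.
move=> m0 l0 h; have l2 : 0 < `|l| / 2 by rewrite divr_gt0// normr_gt0.
have /cvgrPdist_le/(_ _ l2)[N _ hN] := h.
apply: (@cvg_eventually_eq R _ (fun n => ln m / n%:R ^+ 2 + ln `|u n| / n%:R ^+ 2) _ N).
  move=> n /hN /= hn; rewrite -mulrDl normrM gtr0_norm// lnM// posrE normr_gt0.
  apply/eqP => e; have : 0 < `|l| by rewrite normr_gt0.
  by move: hn; rewrite e normr0 ln0// mul0r subr0; lra.
rewrite -[X in _ --> X]add0r; apply: cvgD => //.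
apply: (@cvg_linear_error R (fun=> ln m) 0 `|ln m| 1) => n n1.
by rewrite mul0r subr0 ler_peMr// ler1n.
Qed.

Lemma scale_growth (R : realType) (u : nat -> R) (m beta : R) : 0 < m ->
  (forall e : R, 0 < e -> \forall n \near \oo, `|u n| <= expR ((beta + e) * n%:R ^+ 2)) ->
  forall e : R, 0 < e -> \forall n \near \oo, `|m * u n| <= expR ((beta + e) * n%:R ^+ 2).
Proof.
move=> m0 h e e0; have [N _ hN] := h _ (divr_gt0 e0 (ltr0n R 2)).
exists (maxn N (Num.truncn (2 * ln m / e)).+1) => // n /=; rewrite geq_max => /andP[nN nM].
have n1 : 1 <= n%:R :> R by rewrite ler1n; apply: leq_trans nM.
have : 2 * ln m / e <= n%:R by apply: (le_trans (ltW (truncnS_gt _))); rewrite ler_nat.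
rewrite ler_pdivrMr// => lm.
have -> : m = expR (ln m) by rewrite lnK.
rewrite normrM ger0_norm ?expR_ge0//.
apply: (@le_trans _ _ (expR (ln m) * expR ((beta + e / 2) * n%:R ^+ 2))).
  by rewrite ler_wpM2l ?expR_ge0//; exact: hN.
have : 0 <= n%:R * e * (n%:R - 1) by rewrite !mulr_ge0 ?subr_ge0// ltW.
by rewrite -expRD ler_expR; lra.
Qed.

Unset Implicit Arguments.

Theorem theorem3 (R : realType) (p : nat) (a b : int) (hp : (1 < p)%N)
    (hb : b != 0) :
  let c : R := a%:~R / b%:~R in
  (forall k : nat, (1 <= k)%N -> c * p%:R ^+ k != 1) ->
  let L : R := lambert_sum c p in
  (forall n : nat, approx_num R p a b n \is a Num.int /\ approx_den R p a b n \is a Num.int)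
  /\ (c != 0 ->
      cvgn (fun n : nat => \sum_(1 <= k < n) lambert_term c p k)
      /\ (c != 1 ->
          (fun n : nat =>
             `|approx_den R p a b n * L - approx_num R p a b n| `^ (1 / n%:R ^+ 2)) @ \oo
          --> (p%:R : R) `^ (- ((pi ^+ 2 - 3) / pi ^+ 2)))
      /\ (p%:R : R) `^ (- ((pi ^+ 2 - 3) / pi ^+ 2)) < 1
      /\ irrational L
      /\ (irrationality_measure L <= (3 * pi ^+ 2 / (pi ^+ 2 - 3))%:E)%E)
  /\ (4 + 310 / 10 ^+ 3 + 119 / 10 ^+ 6 <= 3 * pi ^+ 2 / (pi ^+ 2 - 3) :> R)
  /\ (3 * pi ^+ 2 / (pi ^+ 2 - 3) < 4 + 310 / 10 ^+ 3 + 120 / 10 ^+ 6 :> R).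
Proof.
move=> c c_neq L; set t : R := p%:R.
have t_gt1 : 1 < t by rewrite ltr1n.
have t_gt0 : 0 < t by apply: lt_trans t_gt1.
have lp0 : 0 < ln t by rewrite ln_gt0.
pose rho := ln t * ((pi ^+ 2 - 3) / pi ^+ 2) : R.
pose beta := ln t * (2 + 3 / pi ^+ 2) : R.
have pi4 : 4 <= pi ^+ 2 :> R by have := @pi_ge2 R; rewrite expr2; nra.
have rho0 : 0 < rho by rewrite mulr_gt0// divr_gt0//; lra.
have beta0 : 0 <= beta by rewrite mulr_ge0 ?(ltW lp0)// addr_ge0// divr_ge0//; lra.
(* rho + beta = 3 ln t, so the ratio is 3 / (1 - 3/pi^2). *)
have expE : 1 + beta / rho = 3 * pi ^+ 2 / (pi ^+ 2 - 3).
  rewrite /beta /rho; move: (pi ^+ 2 : R) pi4 => z z4.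
  by field; rewrite !gt_eqF//; lra.
have powE : t `^ (- ((pi ^+ 2 - 3) / pi ^+ 2)) = expR (- rho).
  by rewrite /powR gt_eqF// mulNr mulrC.
split; first by move=> n; exact: approx_int.
split; last exact: irrationality_exponent_bounds.
move=> c0.
have cneq' : c != 1 -> forall k, c * t ^+ k != 1.
  by move=> c1 [|k]; [rewrite expr0 mulr1|exact: c_neq].
have [A [B [h1 h2]]] : exists A B : nat -> int,
  (fun n => ln `|(B n)%:~R * L - (A n)%:~R| / n%:R ^+ 2) @ \oo --> - rho /\
  forall e : R, 0 < e ->
    \forall n \near \oo, `|(B n)%:~R : R| <= expR ((beta + e) * n%:R ^+ 2).
  have [c1|c1] := eqVneq c 1; last first.
    exact: (lambert_linear_forms hp hb c0 (cneq' c1)).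
  have tE : (p%:Z)%:~R / 1%:~R = t by rewrite divr1.
  have t0' : (p%:Z)%:~R / 1%:~R != 0 :> R by rewrite tE gt_eqF.
  have tne k : (p%:Z)%:~R / 1%:~R * t ^+ k != 1 by rewrite tE -exprS expt_neq1.
  have [A [B [h1 h2]]] := lambert_linear_forms hp (oner_neq0 _) t0' tne.
  (* L = 1/(p-1) + L(p), so multiplying the forms in 1, L(p) by p - 1 gives
     integer forms in 1, L *)
  exists (fun n => B n + (p%:Z - 1) * A n), (fun n => (p%:Z - 1) * B n).
  have tm0 : 0 < t - 1 by rewrite subr_gt0.
  have formE n : ((p%:Z - 1) * B n)%:~R * L - (B n + (p%:Z - 1) * A n)%:~R =
     (t - 1) * ((B n)%:~R * lambert_sum t p - (A n)%:~R).
    rewrite /L c1 lambert_sum1E// -/t rmorphD !rmorphM rmorphB rmorph1/=.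
    by rewrite -[(p%:~R)]/t; field; rewrite gt_eqF.
  split.
    rewrite (_ : (fun n => _) = fun n => ln `|(t - 1) *
      ((B n)%:~R * lambert_sum t p - (A n)%:~R)| / n%:R ^+ 2).
      by apply: ln_scale_cvg => //; [rewrite oppr_eq0 gt_eqF|rewrite -{1}tE].
    by apply/funext => n; rewrite formE.
  move=> e e0; have := scale_growth tm0 h2 e0.
  by apply: filterS => n; rewrite rmorphM rmorphB rmorph1.
split.
  have [T hT] := @lambert_tail_sum R p hp (c * t ^+ 1) (ltac:(by rewrite mulf_neq0// gt_eqF)).
  exact: cvgP (lambert_sum_cvg hp (ltn0Sn 0) hT).
split.
  move=> c1; rewrite powE; apply: powR_inv_sqr_cvg => //.
    by rewrite oppr_eq0 gt_eqF.
  exact: (approx_form_asymp hp hb c0 (cneq' c1)).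
split; first by rewrite powE expR_lt1 oppr_lt0.
split; first exact: irrational_of_forms rho0 beta0 h1 h2.
by rewrite -expE; exact: irrationality_measure_le rho0 beta0 h1 h2.
Qed.
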